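(* Let $\Lambda$ be a row-finite, aperiodic $\mathbb{N}$-graph with no sources. Suppose that $\{t_\lambda : \lambda \in \Lambda \}$ is a Cuntz–Krieger $\Lambda$-family in a $C^*$-algebra, and let $\pi$ be the homomorphism of $C^{*}(\Lambda)$ such that $\pi (s_\lambda) = t_\lambda$ for all $\lambda \in \Lambda$. If $t_v \neq 0$ for each $v\in\Lambda^0$, then $\pi$ is faithful (injective).
   Context: $\mathbb{N}^{\mathbb{N}}_{0}$ is the monoid of sequences of nonnegative integers with only finitely many nonzero entries, with entrywise addition and entrywise order; $m\vee n$ is the entrywise maximum. An $\mathbb{N}$-graph $(\Lambda,d)$ is a countable small category $\Lambda$ with range and source maps $r,s$ ($\lambda\mu$ is defined when $s(\lambda)=r(\mu)$) and a functor $d:\Lambda\to\mathbb{N}^{\mathbb{N}}_{0}$ with the factorization property: whenever $d(\lambda)=m+n$ there are unique $\mu,\nu\in\Lambda$ with $\lambda=\mu\nu$, $d(\mu)=m$, $d(\nu)=n$. Put $\Lambda^n=d^{-1}(n)$; $\Lambda^0$ is identified with the objects. For $v\in\Lambda^0$, $v\Lambda=\{\lambda\in\Lambda:r(\lambda)=v\}$ and $v\Lambda^n=v\Lambda\cap\Lambda^n$. $\Lambda$ is row-finite if every $v\Lambda^n$ is finite, and has no sources if every $v\Lambda^n$ is nonempty. For $\lambda\in\Lambda$ and $p\le q\le d(\lambda)$, $\lambda(p,q)$ is the unique path $\lambda''$ of degree $q-p$ in the factorization $\lambda=\lambda'\lambda''\lambda'''$ with $d(\lambda')=p$, $d(\lambda'')=q-p$.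 $\Lambda$ is aperiodic if for each $v\in\Lambda^0$ and each pair $n\ne m$ in $\mathbb{N}^{\mathbb{N}}_{0}$ there is $\lambda\in v\Lambda$ with $d(\lambda)\ge m\vee n$ and $\lambda(m,m+d(\lambda)-(m\vee n))\neq\lambda(n,n+d(\lambda)-(m\vee n))$. A Cuntz–Krieger $\Lambda$-family is a family of partial isometries $\{s_\lambda:\lambda\in\Lambda\}$ in a $C^*$-algebra such that (CK1) $\{s_v:v\in\Lambda^0\}$ are mutually orthogonal projections; (CK2) $s_{\lambda}s_\mu=s_{\lambda\mu}$ if $s(\lambda)=r(\mu)$ and $s_\lambda s_\mu=0$ otherwise; (CK3) $s_\lambda^*s_\lambda=s_{s(\lambda)}$; (CK4) $s_v=\sum_{\lambda\in v\Lambda^n}s_\lambda s_\lambda^*$ for all $v\in\Lambda^0$, $n\in\mathbb{N}^{\mathbb{N}}_{0}$. $C^*(\Lambda)$ is the universal $C^*$-algebra generated by a Cuntz–Krieger $\Lambda$-family $\{s_\lambda\}$. *)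

(* Defs.v *)
From HB Require Import structures.
From mathcomp Require Import all_boot all_order all_algebra.
From mathcomp Require Import finmap multiset complex.
From mathcomp Require Import all_classical all_reals all_analysis.

Set Implicit Arguments.
Unset Strict Implicit.
Unset Printing Implicit Defensive.

Import Order.TTheory GRing.Theory Num.Theory.
Import numFieldNormedType.Exports.

Local Open Scope classical_set_scope.
Local Open Scope ring_scope.

(* A multiset over nat is a finitely supported function nat -> nat.  On such
   functions `+`, `\`, `|` and `<=` are the entrywise sum, truncated
   difference, maximum and order. *)
Definition degree := {mset nat}%mset.

(* Composition is a total function on paths: [gcomp l m] is meaningful only if
   [gsrc l = grng m], and no axiom constrains it otherwise. *)
Record Ngraph := MkNgraph {
  gobj : countType;
  gpath :> countType;
  grng : gpath -> gobj;
  gsrc : gpath -> gobj;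
  gid : gobj -> gpath;
  gcomp : gpath -> gpath -> gpath;
  gdeg : gpath -> degree;
  grng_id : forall v, grng (gid v) = v;
  gsrc_id : forall v, gsrc (gid v) = v;
  grng_comp : forall l m, gsrc l = grng m -> grng (gcomp l m) = grng l;
  gsrc_comp : forall l m, gsrc l = grng m -> gsrc (gcomp l m) = gsrc m;
  gcomp_idl : forall l, gcomp (gid (grng l)) l = l;
  gcomp_idr : forall l, gcomp l (gid (gsrc l)) = l;
  gcompA : forall l m n, gsrc l = grng m -> gsrc m = grng n ->
    gcomp l (gcomp m n) = gcomp (gcomp l m) n;
  gdeg_id : forall v, gdeg (gid v) = mset0;
  gdeg_comp : forall l m, gsrc l = grng m ->
    gdeg (gcomp l m) = (gdeg l `+` gdeg m)%mset;
  gfactor : forall (l : gpath) (m n : degree), gdeg l = (m `+` n)%mset ->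
    exists! mn : gpath * gpath,
      [/\ gsrc mn.1 = grng mn.2, l = gcomp mn.1 mn.2,
          gdeg mn.1 = m & gdeg mn.2 = n]
}.

Section Graph.
Variable L : Ngraph.

Definition paths_from (v : gobj L) (n : degree) : set L :=
  [set l | grng l = v /\ gdeg l = n].

Definition row_finite := forall v n, finite_set (paths_from v n).

Definition no_sources := forall v n, paths_from v n !=set0.

Definition is_segment (l : L) (p q : degree) (x : L) :=
  exists l' l'' : L,
    [/\ gsrc l' = grng x, gsrc x = grng l'', l = gcomp l' (gcomp x l''),
        gdeg l' = p & gdeg x = (q `\` p)%mset].

(* [segment l p q] is the path written l(p, q); it is characterised by
   [segmentP] and [segment_unique] when p <= q <= d(l), and has the default
   value [l] when no factorization exists. *)
Definition segment (l : L) (p q : degree) : L := xget l [set x | is_segment l p q x].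

Lemma is_segment_inj (l : L) (p q : degree) (x y : L) :
  is_segment l p q x -> is_segment l p q y -> x = y.
Proof.
move=> [a [b [sa sx e da dx]]] [a' [b' [sa' sy e' da' dy]]].
have sab : gsrc a = grng (gcomp x b) by rewrite grng_comp.
have sab' : gsrc a' = grng (gcomp y b') by rewrite grng_comp.
have dl : gdeg l = (p `+` gdeg (gcomp x b))%mset by rewrite {1}e gdeg_comp // da.
have dl' : gdeg l = (p `+` gdeg (gcomp y b'))%mset by rewrite {1}e' gdeg_comp // da'.
have dE : gdeg (gcomp y b') = gdeg (gcomp x b).
  by rewrite -(msetDKB p (gdeg (gcomp x b))) -dl dl' msetDKB.
have [[u w] [_ uniq]] := gfactor dl.
have E1 := uniq (a, gcomp x b) (And4 sab e da erefl).
have E2 := uniq (a', gcomp y b') (And4 sab' e' da' dE).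
have [_ xy] : (a, gcomp x b) = (a', gcomp y b') by rewrite -E1 -E2.
have dz : gdeg (gcomp x b) = ((q `\` p) `+` gdeg b)%mset by rewrite gdeg_comp // dx.
have db : gdeg b' = gdeg b.
  rewrite -(msetDKB (q `\` p)%mset (gdeg b)) -dz xy gdeg_comp // dy.
  by rewrite msetDKB.
have [[u' w'] [_ uniq']] := gfactor dz.
have F1 := uniq' (x, b) (And4 sx erefl dx erefl).
have F2 := uniq' (y, b') (And4 sy xy dy db).
by have [] : (x, b) = (y, b') by rewrite -F1 -F2.
Qed.

Lemma segmentP (l : L) (p q : degree) :
  (p `<=` q)%mset -> (q `<=` gdeg l)%mset -> is_segment l p q (segment l p q).
Proof.
move=> pq ql; apply: (@xgetPex _ l [set x | is_segment l p q x]).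
have pl : (p `<=` gdeg l)%mset by exact: msubset_trans ql.
have dl : gdeg l = (p `+` (gdeg l `\` p))%mset by rewrite msetBDKC.
have [[a z] [[/= sa e da dz] _]] := gfactor dl.
have dz' : gdeg z = ((q `\` p) `+` (gdeg l `\` q))%mset.
  rewrite dz; apply/msetP => i; rewrite !msetE2.
  move/msubsetP: pq => /(_ i); move/msubsetP: ql => /(_ i) hql hpq.
  by rewrite addnBAC // addnBCA // subnn addn0.
have [[x b] [[/= sx e' dx db] _]] := gfactor dz'.
exists x, a, b; split => //; last by rewrite e e'.
by rewrite sa e' grng_comp.
Qed.

Lemma segment_unique (l : L) (p q : degree) (x : L) :
  is_segment l p q x -> segment l p q = x.
Proof.
by move=> lx; apply: (is_segment_inj _ lx); apply: (xgetPex l); exists x.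
Qed.

Definition aperiodic := forall (v : gobj L) (m n : degree), m <> n ->
  exists l : L,
    [/\ grng l = v, ((m `|` n) `<=` gdeg l)%mset &
        segment l m ((m `+` gdeg l) `\` (m `|` n))%mset <>
        segment l n ((n `+` gdeg l) `\` (m `|` n))%mset].

End Graph.

(* C*-algebras are not assumed to be unital, so the product is not a product
   of a MathComp ring; the norm takes its values in the nonnegative elements of
   R[i]. *)
HB.mixin Record CompleteNormedModule_isCStarAlgebra (R : realType) V
    of CompleteNormedModule R[i] V := {
  cmul : V -> V -> V;
  star : V -> V;
  cmulA : associative cmul;
  cmulDl : left_distributive cmul +%R;
  cmulDr : right_distributive cmul +%R;
  cmulZl : forall (a : R[i]) (x y : V), cmul (a *: x) y = a *: cmul x y;
  cmulZr : forall (a : R[i]) (x y : V), cmul x (a *: y) = a *: cmul x y;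
  starK : involutive star;
  starD : {morph star : x y / x + y};
  starZ : forall (a : R[i]) (x : V), star (a *: x) = conjc a *: star x;
  starM : forall x y : V, star (cmul x y) = cmul (star y) (star x);
  cnormM : forall x y : V, `|cmul x y| <= `|x| * `|y|;
  cnorm_star : forall x : V, `|cmul (star x) x| = `|x| ^+ 2
}.

#[short(type="cstarAlgType")]
HB.structure Definition CStarAlgebra (R : realType) :=
  { V of CompleteNormedModule_isCStarAlgebra R V & CompleteNormedModule R[i] V }.

Section CStar.
Variable R : realType.

Definition is_projection (A : cstarAlgType R) (p : A) :=
  cmul p p = p /\ star p = p.

Definition partial_isometry (A : cstarAlgType R) (x : A) :=
  cmul (cmul x (star x)) x = x.

Definition star_morphism (A B : cstarAlgType R) (f : {linear A -> B}) :=
  {morph f : x y / cmul x y} /\ {morph f : x / star x}.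

Definition cstar_subalgebra (A : cstarAlgType R) (S : set A) :=
  [/\ closed S, S 0,
      forall (a : R[i]) x y, S x -> S y -> S (a *: x + y),
      forall x y, S x -> S y -> S (cmul x y) &
      forall x, S x -> S (star x)].

Record CK_family (L : Ngraph) (A : cstarAlgType R) (t : L -> A) : Prop := {
  CK_partial_isometry : forall l, partial_isometry (t l);
  CK1_projection : forall v, is_projection (t (gid v));
  CK1_orthogonal : forall v w : gobj L, v <> w ->
    cmul (t (gid v)) (t (gid w)) = 0;
  CK2_comp : forall l m : L, gsrc l = grng m ->
    cmul (t l) (t m) = t (gcomp l m);
  CK2_zero : forall l m : L, gsrc l <> grng m -> cmul (t l) (t m) = 0;
  CK3 : forall l : L, cmul (star (t l)) (t l) = t (gid (gsrc l));
  CK4 : forall (v : gobj L) (n : degree),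
    t (gid v) = \sum_(l \in paths_from v n) cmul (t l) (star (t l))
}.

Definition generated_by (I : Type) (A : cstarAlgType R) (s : I -> A) :=
  forall S : set A, cstar_subalgebra S -> (forall i, S (s i)) -> S = setT.

(* (A, s) is the graph algebra C*(L) with its generating family, described up
   to isomorphism by its universal property. *)
Record universal_CK_family (L : Ngraph) (A : cstarAlgType R) (s : L -> A) : Prop := {
  universal_CK : CK_family s;
  universal_generated : generated_by s;
  universal_lift : forall (B : cstarAlgType R) (t : L -> B), CK_family t ->
    exists2 f : {linear A -> B}, star_morphism f & forall l, f (s l) = t l
}.

End CStar.

(* Main.v *)
(* For a in the *-algebra spanned by the s_l s_m^*, let Phi_{p,q}(a) keep the terms
   with p + d(l) = q + d(m).  Aperiodicity gives |Phi_{p,q}(a)| <= |pi(a)|: after all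
   l have been extended to one degree, a compression by the projections
   t_{i k} t_{i k}^*, where k separates the finitely many degrees that occur, kills
   the images of the other terms and maps the remaining ones to matrix units.  The
   norm of a sum of matrix units does not depend on the algebra, because
   |X|^(2N) = |(X^* X)^N| grows like the largest coefficient of (X^* X)^N.

   By universality the gauge rotations s_l |-> chi(d(l)) s_l are contractive on
   C*(L), so the Fejer mean 1/|E| sum_{p,q in E} Phi_{p,q} over a box E of degrees is
   contractive, and it is close to the identity on a given a0 when E is large.  If
   pi(a) = 0, choose a0 near a, then E, then a1 so near a that |E| |a - a1| is
   small: the mean of a1 is bounded by |E| |pi(a1)| <= |E| |a1 - a|, so a0, and with
   it a, is small.

   Two facts on C*-algebras need no spectral theory.  A *-homomorphism
   contracts norms, as a self-adjoint h with |h| < 1 is the real part of the unitary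
   h + i sqrt(1 - h^2).  Projections whose sum is a projection are orthogonal, by
   Cauchy's estimate for the powers of e + c x with |c| = 1. *)

Require Import Defs.
From HB Require Import structures.
From mathcomp Require Import all_boot all_order all_algebra.
From mathcomp Require Import finmap multiset complex cyclic separable ring lra zify.
From mathcomp Require cyclotomic.
From mathcomp Require Import all_classical all_reals all_analysis.

Set Implicit Arguments.
Unset Strict Implicit.
Unset Printing Implicit Defensive.

Import Order.TTheory GRing.Theory Num.Theory.
Import numFieldNormedType.Exports.

Local Open Scope ring_scope.

Local Notation "x ** y" := (cmul x y) (at level 40, left associativity).
Local Notation "x ^#" := (star x) (at level 2, format "x ^#").

(** * Elementary estimates in C*-algebras *)

Section RealNorm.
Variable R : realType.

(** The norm of a C*-algebra takes its values in [R[i]]; its real part places all estimates in the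
    ordered field [R]. *)
Definition nm (V : normedZmodType R[i]) (x : V) : R := complex.Re `|x|.

Section Zmod.
Variable V : normedZmodType R[i].
Implicit Types x y : V.

Lemma nmE x : `|x| = (nm x)%:C%C.
Proof. by rewrite /nm RRe_real // normr_real. Qed.

Lemma nm_ge0 x : 0 <= nm x.
Proof. by rewrite -ler0c -nmE. Qed.

Lemma nm0 : nm (0 : V) = 0.
Proof. by rewrite /nm normr0. Qed.

Lemma nm_eq0 x : nm x = 0 -> x = 0.
Proof. by move=> h; apply: normr0_eq0; rewrite nmE h. Qed.

Lemma nmN x : nm (- x) = nm x.
Proof. by rewrite /nm normrN. Qed.

Lemma nmBC x y : nm (x - y) = nm (y - x).
Proof. by rewrite /nm distrC. Qed.

Lemma nmD x y : nm (x + y) <= nm x + nm y.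
Proof. by rewrite -lecR rmorphD /= -!nmE; exact: ler_normD. Qed.

Lemma nmB x y : nm (x - y) <= nm x + nm y.
Proof. by rewrite -(nmN y) nmD. Qed.

Lemma nm_sum (I : Type) (r : seq I) (P : pred I) (F : I -> V) :
  nm (\sum_(i <- r | P i) F i) <= \sum_(i <- r | P i) nm (F i).
Proof.
elim/big_rec2: _ => [|i y x _ h]; first by rewrite nm0.
by rewrite (le_trans (nmD _ _)) // lerD2l.
Qed.

End Zmod.

Lemma nmc_real (a : R) : nm (a%:C%C : R[i]) = `|a|.
Proof. by rewrite /nm normc_def /= expr0n addr0 sqrtr_sqr. Qed.

Lemma nmcM (a b : R[i]) : nm (a * b) = nm a * nm b.
Proof. by apply: complexI; rewrite rmorphM /= -!nmE normrM. Qed.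

Lemma nmcX (a : R[i]) k : nm (a ^+ k) = nm a ^+ k.
Proof. by apply: complexI; rewrite rmorphXn /= -!nmE normrX. Qed.

Lemma nmc1 : nm (1 : R[i]) = 1.
Proof. by rewrite /nm normr1. Qed.

Lemma nmc_nat k : nm (k%:R : R[i]) = k%:R.
Proof. by rewrite /nm normr_nat -(rmorph_nat (@real_complex_def R (Phant R))). Qed.

Lemma nmcV (a : R[i]) : nm a^-1 = (nm a)^-1.
Proof. by apply: complexI; rewrite -nmE normfV nmE fmorphV. Qed.

Lemma nmc_conj (a : R[i]) : nm (conjc a) = nm a.
Proof. by case: a => a b; rewrite /nm !normc_def /= sqrrN. Qed.

Lemma mulcJ (a : R[i]) : a * conjc a = (nm a ^+ 2)%:C%C.
Proof.
rewrite rmorphXn /= -nmE -add_Re2_Im2; case: a => a b; simpc.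
by congr (_ +i* _)%C; ring.
Qed.

End RealNorm.

Section CStarBasics.
Variables (R : realType) (A : cstarAlgType R).
Implicit Types (x y z : A) (a b : R[i]).

Lemma nmZ a x : nm (a *: x) = nm a * nm x.
Proof. by apply: complexI; rewrite rmorphM /= -!nmE normrZ. Qed.

Lemma nmM x y : nm (x ** y) <= nm x * nm y.
Proof. by rewrite -lecR rmorphM /= -!nmE; exact: cnormM. Qed.

Lemma nm_star_mul x : nm (x^# ** x) = nm x ^+ 2.
Proof. by apply: complexI; rewrite rmorphXn /= -!nmE; exact: cnorm_star. Qed.

Lemma nm_star x : nm x^# = nm x.
Proof.
have le y : nm y <= nm y^#.
  have := nm_star_mul y; have := nmM y^# y; have := nm_ge0 y.
  rewrite le_eqVlt => /predU1P[<- _ _|]; first exact: nm_ge0.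
  by move=> y0 + e; rewrite e expr2 ler_pM2r.
by apply/eqP; rewrite eq_le le -{2}(starK x) le.
Qed.

Lemma cmulBl x y z : (x - y) ** z = x ** z - y ** z.
Proof. by rewrite -scaleN1r cmulDl cmulZl scaleN1r. Qed.
Lemma cmulBr x y z : z ** (x - y) = z ** x - z ** y.
Proof. by rewrite -scaleN1r cmulDr cmulZr scaleN1r. Qed.
Lemma cmul0l x : 0 ** x = 0.
Proof. by rewrite -(scale0r (0 : A)) cmulZl !scale0r. Qed.
Lemma cmul0r x : x ** 0 = 0.
Proof. by rewrite -(scale0r (0 : A)) cmulZr !scale0r. Qed.

Lemma cmul_suml (I : Type) (r : seq I) (P : pred I) (F : I -> A) y :
  (\sum_(i <- r | P i) F i) ** y = \sum_(i <- r | P i) F i ** y.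
Proof. by elim/big_rec2: _ => [|i u v _ <-]; rewrite ?cmul0l ?cmulDl. Qed.

Lemma cmul_sumr (I : Type) (r : seq I) (P : pred I) (F : I -> A) y :
  y ** (\sum_(i <- r | P i) F i) = \sum_(i <- r | P i) y ** F i.
Proof. by elim/big_rec2: _ => [|i u v _ <-]; rewrite ?cmul0r ?cmulDr. Qed.

Lemma star0 : (0 : A)^# = 0.
Proof. by apply: nm_eq0; rewrite nm_star nm0. Qed.
Lemma starN x : (- x)^# = - x^#.
Proof. by rewrite -scaleN1r starZ rmorphN rmorph1 scaleN1r. Qed.
Lemma starB x y : (x - y)^# = x^# - y^#.
Proof. by rewrite starD starN. Qed.
Lemma star_sum (I : Type) (r : seq I) (P : pred I) (F : I -> A) :
  (\sum_(i <- r | P i) F i)^# = \sum_(i <- r | P i) (F i)^#.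
Proof. by elim/big_rec2: _ => [|i u v _ <-]; rewrite ?star0 ?starD. Qed.

Lemma star_mul_eq0 x : x^# ** x = 0 -> x = 0.
Proof.
by move=> h; apply: nm_eq0; apply/eqP; rewrite -sqrf_eq0 -nm_star_mul h nm0.
Qed.

Lemma nm_self_adjoint x : x^# = x -> nm (x ** x) = nm x ^+ 2.
Proof. by move=> h; rewrite -{1}h nm_star_mul. Qed.

Lemma nm_projection x : is_projection x -> nm x <= 1.
Proof.
move=> [xx xs]; have := nm_self_adjoint xs; rewrite xx.
by move=> h; have := nm_ge0 x; nra.
Qed.

Lemma nm_projection1 x : is_projection x -> x <> 0 -> nm x = 1.
Proof.
move=> [xx xs] x0; have := nm_self_adjoint xs; rewrite xx.
have : nm x != 0 by apply/eqP => /nm_eq0.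
by move=> h0 /eqP; rewrite expr2 -{1}[nm x]mul1r (inj_eq (mulIf h0)) => /eqP.
Qed.

End CStarBasics.

(** * Limits of sequences with geometrically decreasing steps *)

Section Limits.
Local Open Scope classical_set_scope.
Variable R : realType.

Lemma eventually_expr_lt (r C e : R) : 0 <= r -> r < 1 -> 0 <= C -> 0 < e ->
  exists N, forall n, (N <= n)%N -> C * r ^+ n < e.
Proof.
move=> r0 r1 C0 e0.
have C10 : 0 < C + 1 by rewrite ltr_wpDl.
have : (@GRing.exp R r) @ \oo --> (0 : R) by apply: cvg_expr; rewrite ger0_norm.
move=> /cvgrPdist_lt /(_ (e / (C + 1)) (divr_gt0 e0 C10)) [N _ h].
exists N => n Nn; have := h n Nn; rewrite /= sub0r normrN ger0_norm ?exprn_ge0 //.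
rewrite ltr_pdivlMr // => h1; apply: le_lt_trans h1.
by rewrite mulrC ler_wpM2l ?exprn_ge0 // lerDl.
Qed.

Lemma nm_dist_geometric (V : normedZmodType R[i]) (u : nat -> V) (C r : R) :
  0 <= r -> r < 1 -> (forall n, nm (u n.+1 - u n) <= C * r ^+ n) ->
  forall m n, nm (u (m + n)%N - u m) <= C / (1 - r) * r ^+ m.
Proof.
move=> r0 r1 h m n.
have r1' : 0 < 1 - r by rewrite subr_gt0.
have C0 : 0 <= C by have := le_trans (nm_ge0 _) (h 0%N); rewrite expr0 mulr1.
suff : nm (u (m + n)%N - u m) <= C / (1 - r) * (r ^+ m - r ^+ (m + n)).
  move=> /le_trans; apply; rewrite ler_wpM2l ?gerBl ?exprn_ge0 //.
  by rewrite divr_ge0 // ltW.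
elim: n => [|n IH]; first by rewrite addn0 !subrr nm0 mulr0.
rewrite addnS -[u _.+1](subrK (u (m + n)%N)) -addrA.
apply: le_trans (nmD _ _) _; apply: le_trans (lerD (h _) IH) _.
rewrite le_eqVlt; apply/orP; left; apply/eqP.
by rewrite exprS; field; rewrite gt_eqF.
Qed.

Lemma geometric_limit (A : completeNormedModType R[i]) (u : nat -> A) (C r : R) :
  0 <= r -> r < 1 -> (forall n, nm (u n.+1 - u n) <= C * r ^+ n) ->
  exists l, forall e : R, 0 < e ->
    exists N, forall n, (N <= n)%N -> nm (l - u n) < e.
Proof.
move=> r0 r1 h.
have C0 : 0 <= C by have := le_trans (nm_ge0 _) (h 0%N); rewrite expr0 mulr1.
have C0' : 0 <= C / (1 - r) by rewrite divr_ge0 // subr_ge0 ltW.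
have : cauchy (u @ \oo).
  apply: cauchy_exP => e e0.
  have [e1 ee] : exists e1 : R, e = e1%:C%C.
    by apply/complex_realP; exact: gtr0_real.
  rewrite ee ltcR in e0 *.
  have [N hN] := eventually_expr_lt r0 r1 C0' e0.
  exists (u N); exists N => // n /= Nn; rewrite -ball_normE /= nmE ltcR nmBC.
  rewrite -(subnKC Nn); apply: le_lt_trans (hN N (leqnn _)).
  exact: nm_dist_geometric.
move=> /cauchy_cvg /cvg_ex[l /cvgrPdist_lt hl]; exists l => e e0.
have [|N _ hN] := hl e%:C%C; first by rewrite ltcR.
by exists N => n Nn; have := hN n Nn; rewrite /= nmE ltcR.
Qed.

(** For passing an identity to a limit. Two successive terms occur because the recursion below links
    [u n] with [u n.+1]. *)
Lemma nm_approx_eq (V : normedZmodType R[i]) (x y : V) (T : normedZmodType R[i])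
    (l : T) (u : nat -> T) (K : R) :
  (forall e : R, 0 < e -> exists N, forall n, (N <= n)%N -> nm (l - u n) < e) ->
  (forall n, nm (x - y) <= K * (nm (l - u n) + nm (l - u n.+1))) -> x = y.
Proof.
move=> hl h; apply/eqP; rewrite -subr_eq0; apply/eqP/nm_eq0/eqP.
rewrite eq_le nm_ge0 andbT; apply/ler_addgt0Pl => e e0; rewrite addr0.
have K1 : 0 < 2 * (`|K| + 1) by rewrite mulr_gt0 // ltr_wpDl.
have [n hn] := hl _ (divr_gt0 e0 K1).
apply: le_trans (h n) _; have := hn n (leqnn _); have := hn _ (leqnSn n).
rewrite !ltr_pdivlMr // => h1 h2.
have : K * (nm (l - u n) + nm (l - u n.+1)) <=
       (`|K| + 1) * (nm (l - u n) + nm (l - u n.+1)).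
  by rewrite ler_wpM2r ?addr_ge0 ?nm_ge0 //; have := ler_norm K; lra.
lra.
Qed.

End Limits.

(** * A square root of [1 - h^2] by iteration *)

Section SqrtDefect.
Variables (R : realType) (A : cstarAlgType R) (h : A).

(** Iteration for the fixed point [2 b = h^2 + b^2], that is, [(1 - b)^2 = 1 - h^2]. *)
Fixpoint sqrt_defect_seq n : A :=
  if n is m.+1 then 2^-1 *: (h ** h + sqrt_defect_seq m ** sqrt_defect_seq m) else 0.

Local Notation b := sqrt_defect_seq.

Lemma nmc_half : nm (2^-1 : R[i]) = 2^-1.
Proof. by rewrite nmcV nmc_nat. Qed.

Lemma conj_half : conjc (2^-1 : R[i]) = 2^-1.
Proof. by rewrite conjc_inv conjc_nat. Qed.

Hypotheses (hs : h^# = h) (h1 : nm h < 1).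

(** Since [nm h < 1], the norm bound gives [nm (b n) <= nm h], so the mean of [h ** h] and
    [b n ** b n] obeys it again. *)
Lemma sqrt_defect_seqP n :
  [/\ (b n)^# = b n, h ** b n = b n ** h & nm (b n) <= nm h ^+ 2].
Proof.
elim: n => [|n [IH1 IH2 IH3]] /=.
  by rewrite star0 cmul0l cmul0r nm0 sqr_ge0.
split.
- by rewrite starZ starD !starM hs IH1 conj_half.
- by rewrite cmulZr cmulZl cmulDr cmulDl !cmulA IH2 -!cmulA IH2.
- rewrite nmZ nmc_half; have := nmD (h ** h) (b n ** b n).
  have := nmM h h; have := nmM (b n) (b n).
  have : nm (b n) * nm (b n) <= nm h * nm h.
    have := nm_ge0 h; have := nm_ge0 (b n) => b0 h0.
    have le : nm (b n) <= nm h by apply: le_trans IH3 _; rewrite expr2 ler_piMr // ltW.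
    exact: ler_pM.
  rewrite expr2; lra.
Qed.

(* [1 - b] is the square root of [1 - h ** h], written without a unit. *)
Lemma sqrt_defect :
  exists b : A, [/\ b^# = b, h ** b = b ** h & h ** h = b + b - b ** b].
Proof.
have r0 : 0 <= nm h ^+ 2 by exact: sqr_ge0.
have r1 : nm h ^+ 2 < 1 by rewrite expr_lt1 ?nm_ge0.
have bS n : nm (b n.+1 - b n) <= nm (h ** h) * (nm h ^+ 2) ^+ n.
  elim: n => [|n IH].
    rewrite /= cmul0l addr0 subr0 nmZ nmc_half expr0 mulr1.
    by have := nm_ge0 (h ** h); lra.
  rewrite [X in nm (X - _)]/= [b n.+1 in X in nm (_ - X)]/= -scalerBr.
  (* The factors [b n.+1] and [b n] have norm at most [|h|^2], so after halving the differences
     shrink by the ratio [|h|^2]. *)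
  have -> : h ** h + b n.+1 ** b n.+1 - (h ** h + b n ** b n) =
            b n.+1 ** (b n.+1 - b n) + (b n.+1 - b n) ** b n.
    by rewrite cmulBr cmulBl opprD addrACA subrr add0r addrA subrK.
  rewrite nmZ nmc_half exprS.
  have [_ _ n1] := sqrt_defect_seqP n; have [_ _ n2] := sqrt_defect_seqP n.+1.
  have := nmD (b n.+1 ** (b n.+1 - b n)) ((b n.+1 - b n) ** b n).
  have := nmM (b n.+1) (b n.+1 - b n); have := nmM (b n.+1 - b n) (b n).
  have := nm_ge0 (b n.+1 - b n); set d := nm (b n.+1 - b n) in IH *.
  move=> d0 e1 e2 e3.
  have := ler_wpM2l d0 n1; have := ler_wpM2l d0 n2; have := ler_wpM2l r0 IH.
  lra.
have [l hl] := geometric_limit r0 r1 bS; exists l; split.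
- apply: (nm_approx_eq (K := 2) hl) => n; have [s _ _] := sqrt_defect_seqP n.
  rewrite -[X in nm X](subrKA (b n)) -{1}s -starB.
  apply: le_trans (nmD _ _) _; rewrite nm_star nmBC [nm (b n - l)]nmBC.
  by have := nm_ge0 (l - b n.+1); lra.
- apply: (nm_approx_eq (K := 2 * nm h) hl) => n; have [_ s _] := sqrt_defect_seqP n.
  have -> : h ** l - l ** h = h ** (l - b n) - (l - b n) ** h.
    by rewrite cmulBl cmulBr s opprB addrA subrK.
  apply: le_trans (nmB _ _) _.
  have := nmM h (l - b n); have := nmM (l - b n) h.
  have := mulr_ge0 (nm_ge0 h) (nm_ge0 (l - b n.+1)); lra.
- have l1 : nm l <= 1.
    apply/ler_addgt0Pl => e e0; have [N /(_ N (leqnn _)) lN] := hl e e0.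
    have [_ _ bN] := sqrt_defect_seqP N.
    by rewrite -[l](subrK (b N)); apply: le_trans (nmD _ _) _; lra.
  apply: (nm_approx_eq (K := 2) hl) => n; have [_ _ bn] := sqrt_defect_seqP n.
  (* The recursion expresses [h ** h] through [b n.+1] and [b n], so the defect involves only their
     distances from [l]. *)
  have -> : h ** h = b n.+1 + b n.+1 - b n ** b n.
    by rewrite /= -mulr2n -scaler_nat scalerA mulfV ?pnatr_eq0 // scale1r addrK.
  have -> : b n.+1 + b n.+1 - b n ** b n - (l + l - l ** l) =
      (l ** (l - b n) + (l - b n) ** b n) - ((l - b n.+1) + (l - b n.+1)).
    rewrite cmulBr cmulBl addrA subrK (addrACA l) -(opprD (b n.+1)) opprB.
    by rewrite opprB [LHS]addrACA [RHS]addrACA (addrC (l ** l)).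
  apply: le_trans (nmB _ _) _.
  have := nmD (l ** (l - b n)) ((l - b n) ** b n).
  have := nmM l (l - b n); have := nmM (l - b n) (b n).
  have := nmD (l - b n.+1) (l - b n.+1).
  have := ler_wpM2r (nm_ge0 (l - b n)) l1.
  have := ler_wpM2l (nm_ge0 (l - b n)) (le_trans bn (ltW r1)).
  lra.
Qed.

End SqrtDefect.

(** * Contractivity of star-homomorphisms *)

Section Contractive.
Variable R : realType.

Section Bound.
Variables (A : cstarAlgType R) (h b : A).
Hypotheses (hs : h^# = h) (bs : b^# = b) (hb : h ** b = b ** h).
Hypothesis (hh : h ** h = b + b - b ** b).

(* For [c = 'i] and [c = - 'i], the element [h + c (1 - b)] is unitary, and [h] is
   the mean of the two. *)
Lemma nm_unitary_action (c : R[i]) (x : A) : c * conjc c = 1 -> conjc c = - c ->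
  nm (h ** x + c *: (x - b ** x)) = nm x.
Proof.
move=> cc cN; apply/eqP; rewrite -(@eqrXn2 _ 2) ?nm_ge0 // -!nm_star_mul.
have bx : (b ** x)^# = x^# ** b by rewrite starM bs.
have hx : (h ** x)^# = x^# ** h by rewrite starM hs.
apply/eqP; congr nm.
rewrite starD starZ cN starB bx hx cmulDr !cmulDl !cmulZl !cmulZr.
(* As [h] commutes with [b], the cross terms differ only in the factors [c] and [conjc c = - c], and
   cancel. *)
have -> : x^# ** h ** (x - b ** x) = (x^# - x^# ** b) ** (h ** x).
  by rewrite cmulBl cmulBr !cmulA -(cmulA x^# h b) hb cmulA.
rewrite scalerA -cN mulrC cc scale1r.
rewrite addrA -[_ + _ + _ *: _]addrA -scalerDl cN addNr scale0r addr0.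
have -> : x^# ** h ** (h ** x) = x^# ** (h ** h) ** x by rewrite !cmulA.
rewrite hh cmulBl !cmulBr cmulBl cmulDr cmulDl !cmulA.
set y := x^# ** b ** x; set z := x^# ** b ** b ** x.
have -> : x^# ** x - y - (y - z) = x^# ** x - (y + y - z).
  by rewrite -addrA -opprD addrA.
by rewrite addrC subrK.
Qed.

(** As a mean of two isometric actions, left multiplication by [h] is a contraction; apply it to [h]
    itself and use [|h ** h| = |h|^2]. *)
Lemma nm_real_part_le1 : nm h <= 1.
Proof.
have ii : 'i%C * conjc 'i%C = 1 :> R[i] by simpc.
have iN : conjc 'i%C = - 'i%C :> R[i] by simpc.
have hle x : nm (h ** x) <= nm x.
  have e1 := nm_unitary_action x ii iN.
  have e2 : nm (h ** x + (- 'i%C) *: (x - b ** x)) = nm x.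
    apply: nm_unitary_action; first by rewrite rmorphN mulrNN.
    by rewrite rmorphN; congr (- _).
  have := nmD (h ** x + 'i%C *: (x - b ** x)) (h ** x + (- 'i%C) *: (x - b ** x)).
  rewrite addrACA -scalerDl subrr scale0r addr0 -mulr2n -scaler_nat nmZ nmc_nat.
  rewrite e1 e2; lra.
have := hle h; rewrite nm_self_adjoint // expr2; have := nm_ge0 h; nra.
Qed.

End Bound.

(** For self-adjoint [h] with [|h| < 1] the images of [h] and [b] satisfy the relations of [h] and
    [b], so [|f h| <= 1]. Scaling extends this to all self-adjoint elements, and the C*-identity for
    [x^# ** x] to all [x]. *)
Lemma nm_star_morphism (A B : cstarAlgType R) (f : {linear A -> B}) :
  star_morphism f -> forall x, nm (f x) <= nm x.
Proof.
move=> [fM fs] x.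
have lt1 h : h^# = h -> nm h < 1 -> nm (f h) <= 1.
  move=> hs h1; have [b [bs hb hh]] := sqrt_defect hs h1.
  apply: (@nm_real_part_le1 _ (f h) (f b)); rewrite -?fs -?fM ?hs ?bs ?hb //.
  by rewrite hh linearB linearD fM.
have sa h : h^# = h -> nm (f h) <= nm h.
  move=> hs; apply/ler_addgt0Pl => e e0.
  have c0 : 0 < e + nm h by rewrite ltr_pwDl ?nm_ge0.
  have nV : nm (((e + nm h)^-1)%:C%C : R[i]) = (e + nm h)^-1.
    by rewrite nmc_real ger0_norm // invr_ge0 ltW.
  have := lt1 (((e + nm h)^-1)%:C%C *: h).
  rewrite starZ hs conjc_real linearZ !nmZ nV => /(_ erefl).
  rewrite ![(e + nm h)^-1 * _]mulrC ltr_pdivrMr // ler_pdivrMr // !mul1r.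
  by apply; rewrite ltrDr.
have := sa (x^# ** x); rewrite starM starK fM fs !nm_star_mul => /(_ erefl).
by rewrite ler_pXn2r ?nnegrE ?nm_ge0.
Qed.

End Contractive.

(** * Roots of unity and their averages *)

Section RootsOfUnity.
Variable R : realType.

Lemma prim_root_exists n : (0 < n)%N -> exists z : R[i], n.-primitive_root z.
Proof.
move=> n0; have [rs /esym] := closed_field_poly_normal ('X^n - 1 : {poly R[i]}).
rewrite (monicP (monicXnsubC _ n0)) scale1r => rsE.
suff /hasP[z _ zP] : has n.-primitive_root rs by exists z.
apply: has_prim_root => //.
- by apply/allP => z; rewrite -root_prod_XsubC rsE.
- rewrite -separable_prod_XsubC rsE.
  by rewrite cyclotomic.separable_Xn_sub_1 // pnatr_eq0 -lt0n.
- by have := size_prod_XsubC rs id; rewrite rsE size_XnsubC // => -[->].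
Qed.

Lemma nm_root_of_unity n (z : R[i]) : (0 < n)%N -> z ^+ n = 1 -> nm z = 1.
Proof.
move=> n0 zn; apply/eqP; rewrite -(@eqrXn2 _ n) ?nm_ge0 // -nmcX zn nmc1.
by rewrite expr1n.
Qed.

(** Orthogonality of characters of a cyclic group: for [a != b] the sum is geometric, with ratio an
    [n]-th root of unity other than 1. *)
Lemma prim_root_average n (z : R[i]) (a b : nat) : n.-primitive_root z ->
  (a < n)%N -> (b < n)%N ->
  n%:R^-1 * \sum_(j < n) (z ^+ j) ^+ a * conjc ((z ^+ j) ^+ b) = (a == b)%:R.
Proof.
move=> zn an bn; have n0 : (0 < n)%N by apply: leq_ltn_trans an.
have z1 : nm z = 1 by exact: nm_root_of_unity (prim_expr_order zn).
pose q := z ^+ a * conjc (z ^+ b).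
have zz k : z ^+ k * conjc (z ^+ k) = 1 by rewrite mulcJ nmcX z1 !expr1n.
have -> : \sum_(j < n) (z ^+ j) ^+ a * conjc ((z ^+ j) ^+ b) = \sum_(j < n) q ^+ j.
  by apply: eq_bigr => j _; rewrite exprMn -rmorphXn -!exprM ![(j * _)%N]mulnC.
have [ab|nab] := eqVneq a b.
  rewrite (eq_bigr (fun=> 1)) => [|j _]; last by rewrite /q ab zz expr1n.
  by rewrite sumr_const card_ord mulVf // pnatr_eq0 -lt0n.
have qn : q ^+ n = 1.
  by rewrite exprMn -rmorphXn -!exprM ![(_ * n)%N]mulnC !exprM
    (prim_expr_order zn) !expr1n rmorph1 mulr1.
have q1 : q != 1.
  apply: contra nab => /eqP q1.
  have : z ^+ a = q * z ^+ b by rewrite /q -mulrA [conjc _ * _]mulrC zz mulr1.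
  rewrite q1 mul1r => /eqP; by rewrite (eq_prim_root_expr zn) !modn_small.
have := subrX1 q n; rewrite qn subrr => /esym/eqP.
by rewrite mulf_eq0 subr_eq0 (negPf q1) /= => /eqP ->; rewrite mulr0.
Qed.

End RootsOfUnity.

(** * Orthogonality of projections that add up to a projection *)

Section OrthogonalProjections.
Variables (R : realType) (A : cstarAlgType R).

Section Extreme.
Variables (e x : A).
Hypotheses (eP : is_projection e) (xs : x^# = x) (ex : e ** x = x) (xe : x ** e = x).
Hypotheses (nD : nm (e + x) <= 1) (nB : nm (e - x) <= 1).

Lemma cmul_affine (c d : R[i]) :
  (e + c *: x) ** (e + d *: x) = e + (c + d) *: x + (c * d) *: (x ** x).
Proof.
have [ee es] := eP.
rewrite !(cmulDl, cmulDr, cmulZl, cmulZr) ee ex xe scalerA scalerDl.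
by rewrite [c *: x + d *: x]addrC !addrA.
Qed.

(* For [t = Re c], [|e + c x|^2] is the convex combination
   [(1 + t)/2 (e + x)^2 + (1 - t)/2 (e - x)^2]. *)
Lemma nm_rotate (c : R[i]) : nm c = 1 -> nm (e + c *: x) <= 1.
Proof.
move=> c1; have [ee es] := eP.
rewrite -(@expr_le1 _ 2) ?nm_ge0 // -nm_star_mul starD starZ es xs.
set t := complex.Re c.
have t2 : t ^+ 2 + complex.Im c ^+ 2 = 1.
  by apply: complexI; rewrite add_Re2_Im2 nmE c1 expr1n.
have [tl tu] : -1 <= t /\ t <= 1.
  by have := sqr_ge0 (complex.Im c); split; nra.
have tt : c + conjc c = (2 * t)%:C%C.
  by rewrite addcJ rmorphM rmorph_nat.
have -> : (e + conjc c *: x) ** (e + c *: x) =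
    ((1 + t) / 2)%:C%C *: ((e + x) ** (e + x)) +
    ((1 - t) / 2)%:C%C *: ((e - x) ** (e - x)).
  rewrite -[in e + x](scale1r x) -[- x]scaleN1r !cmul_affine.
  rewrite [conjc c * c]mulrC mulcJ c1 expr1n mulr1 mulrNN mulr1 [conjc c + c]addrC tt.
  set a := ((1 + t) / 2)%:C%C; set b := ((1 - t) / 2)%:C%C.
  have ab : a + b = 1.
    rewrite /a /b -rmorphD -(rmorph1 (@real_complex_def R (Phant R))).
    by congr (_%:C%C); field.
  have -> : (2 * t)%:C%C = a * (1 + 1) + b * (- 1 - 1).
    by rewrite /a /b; simpc; congr (_ +i* _)%C; field.
  rewrite [in RHS]scalerDr [in RHS]scalerDr [X in _ = _ + X]scalerDr.
  rewrite [X in _ = _ + (X + _)]scalerDr.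
  rewrite [RHS]addrACA [X in _ = X + _]addrACA -!scalerDl ab !scalerA -scalerDl.
  by rewrite mulr1 !scale1r.
apply: le_trans (nmD _ _) _; rewrite !nmZ !nmc_real.
have le1 (u : A) : nm u <= 1 -> nm (u ** u) <= 1.
  by have := nmM u u; have := nm_ge0 u; nra.
have := le1 _ nD; have := le1 _ nB.
have := nm_ge0 ((e + x) ** (e + x)); have := nm_ge0 ((e - x) ** (e - x)).
rewrite !ger0_norm; [nra|lra|lra].
Qed.

(* The coefficient of [c ^ j] in [(e + c x) ^ N]. *)
Fixpoint coef (N j : nat) : A :=
  if N is M.+1 then coef M j + (if j is i.+1 then x ** coef M i else 0)
  else (if j is 0 then e else 0).

Let coefS N j :
  coef N.+1 j = coef N j + (if j is i.+1 then x ** coef N i else 0).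
Proof. by []. Qed.
Arguments coef : simpl never.

Let coefP N j : e ** coef N j = coef N j /\ ((N < j)%N -> coef N j = 0).
Proof.
have [ee _] := eP.
elim: N j => [[|j]|N IH j]; rewrite ?coefS; first by [].
  by rewrite /coef cmul0r.
have [h1 h2] := IH j; case: j h1 h2 => [|j] h1 h2.
  by rewrite addr0; split.
have [h3 h4] := IH j; rewrite cmulDr h1 cmulA ex; split=> // Nj.
by rewrite h2 ?h4 ?cmul0r ?addr0 // ltnW.
Qed.

Let coef1 N : coef N 0 = e /\ coef N 1 = N%:R *: x.
Proof.
elim: N => [|N [IH0 IH1]]; first by rewrite scale0r.
split; first by rewrite coefS IH0 addr0.
by rewrite coefS IH0 IH1 xe !scaler_nat mulrSr.
Qed.

(** The sum is [(e + c x)^N] with [e] as unit, and each factor has norm at most 1 by [nm_rotate]. *)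
Let nm_coef_sum N (c : R[i]) : nm c = 1 ->
  nm (\sum_(j < N.+1) c ^+ j *: coef N j) <= 1.
Proof.
move=> c1; elim: N => [|N IH].
  by rewrite big_ord_recl big_ord0 addr0 scale1r nm_projection.
set y := \sum_(j < N.+1) _ in IH.
have -> : \sum_(j < N.+2) c ^+ j *: coef N.+1 j = (e + c *: x) ** y.
  rewrite cmulDl cmulZl !cmul_sumr.
  under eq_bigr do rewrite coefS scalerDr.
  rewrite big_split /=; congr (_ + _).
    rewrite big_ord_recr /= (coefP N N.+1).2 // scaler0 addr0.
    by apply: eq_bigr => j _; rewrite cmulZr (coefP N j).1.
  rewrite big_ord_recl /= scaler0 add0r scaler_sumr.
  by apply: eq_bigr => j _; rewrite cmulZr scalerA exprS.
by apply: le_trans (nmM _ _) _; rewrite mulr_ile1 ?nm_ge0 ?nm_rotate.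
Qed.

(* Cauchy's estimate for the coefficient [N x] of [c] in [(e + c x) ^ N]. *)
Lemma extreme_eq0 : x = 0.
Proof.
have bound N : nm (N%:R *: x) <= 1.
  (* Order [N.+2] exceeds the exponents [0, ..., N] and also the exponent 1 when [N = 0]. *)
  have [z zP] := prim_root_exists R (ltn0Sn N.+1).
  have zj (j : nat) : nm (z ^+ j) = 1.
    by rewrite nmcX (nm_root_of_unity _ (prim_expr_order zP)) ?expr1n.
  rewrite -(coef1 N).2.
  have -> : coef N 1 = N.+2%:R^-1 *: \sum_(k < N.+2)
      conjc (z ^+ k) *: \sum_(j < N.+1) (z ^+ k) ^+ j *: coef N j.
    under eq_bigr do rewrite scaler_sumr.
    rewrite exchange_big /= scaler_sumr.
    have avg (j : 'I_N.+1) : N.+2%:R^-1 *: \sum_(k < N.+2)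
        conjc (z ^+ k) *: ((z ^+ k) ^+ j *: coef N j) = (j == 1 :> nat)%:R *: coef N j.
      rewrite -(prim_root_average zP) //; last by rewrite ltnS ltnW.
      rewrite -scalerA scaler_suml; congr (_ *: _); apply: eq_bigr => k _.
      by rewrite scalerA mulrC expr1.
    under eq_bigr do rewrite avg.
    case: N {z zP zj avg} => [|N].
      by rewrite big_ord_recl big_ord0 /= scale0r addr0.
    rewrite 2!big_ord_recl big1 /= => [|j _]; last by rewrite scale0r.
    by rewrite scale0r scale1r add0r addr0.
  rewrite nmZ nmcV nmc_nat ler_pdivrMl ?ltr0n // mulr1.
  apply: le_trans (nm_sum _ _ _) _.
  apply: le_trans (ler_sum _ (_ : forall k, _ -> _ <= 1)) _.
    by move=> k _; rewrite nmZ nmc_conj zj mul1r nm_coef_sum.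
  by rewrite sumr_const card_ord.
apply: nm_eq0; apply/eqP; rewrite eq_le nm_ge0 andbT leNgt; apply/negP => x0.
have := bound (Num.bound (nm x)^-1); rewrite nmZ nmc_nat leNgt => /negP; apply.
rewrite -ltr_pdivrMr // div1r; apply: archi_boundP.
by rewrite invr_ge0 ltW.
Qed.

End Extreme.

Lemma nm_reflection (p w : A) : is_projection p -> nm (w - 2 *: (p ** w)) = nm w.
Proof.
move=> [pp ps]; apply/eqP; rewrite -(@eqrXn2 _ 2) ?nm_ge0 // -!nm_star_mul.
apply/eqP; congr nm.
rewrite starB starZ starM ps conjc_nat !(cmulBl, cmulBr, cmulZl, cmulZr).
rewrite !cmulA -(cmulA w^# p p) pp.
set y := 2 *: _; have -> : 2 *: y = y + y by rewrite -mulr2n scaler_nat.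
by rewrite opprB addrK subrK.
Qed.

(* Put [e = P j] and [y k = e P_k e].  Since [1 - 2 P_k] is unitary, [e - 2 y_k] is
   a contraction; as the [y_k] with [k != j] add up to [0], so are both
   [e + x] and [e - x] for a small multiple [x] of [y_i]. *)
Lemma orthogonal_of_sum (I : eqType) (r : seq I) (P : I -> A) (p : A) (i j : I) :
  uniq r -> (forall k, is_projection (P k)) ->
  \sum_(k <- r) P k = p -> (forall k, k \in r -> p ** P k = P k) ->
  i \in r -> j \in r -> i != j -> P i ** P j = 0.
Proof.
move=> ur PP sp pP ir jr ij; set e := P j.
have [ee es] := PP j; have [pi_ pis] := PP i.
pose y k := e ** P k ** e.
have yn k : nm (e - 2 *: y k) <= 1.
  have -> : e - 2 *: y k = e ** (e - 2 *: (P k ** e)).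
    by rewrite cmulBr cmulZr ee cmulA.
  apply: le_trans (nmM _ _) _.
  by rewrite nm_reflection // mulr_ile1 ?nm_ge0 ?nm_projection.
(* The [y k] add up to [e ** p ** e = e], and [y j] is already [e]. *)
have y0 : y i + \sum_(k <- rem i (rem j r)) y k = 0.
  have : e ** p ** e = e ** e by rewrite -cmulA pP.
  rewrite -sp cmul_sumr cmul_suml (big_rem j) //= (big_rem i) /=; last first.
    by rewrite mem_rem_uniq // !inE ij.
  by rewrite -/e !ee => /(congr1 (fun z => z - e)); rewrite addrAC subrr add0r.
set r2 := rem i _ in y0; pose n : R := (size r2).+1%:R.
have n0 : 0 < n by rewrite ltr0n.
have nn : (n%:C%C : R[i]) = (size r2).+1%:R by rewrite rmorph_nat.
have ne : nm e <= 1 by exact: nm_projection.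
(* Both [n e + 2 y i] and [n e - 2 y i] are sums of [n] contractions, [n - 1] being the number of
   indices other than [i] and [j]. *)
have nD : nm (n%:C%C *: e + 2 *: y i) <= n.
  have -> : n%:C%C *: e + 2 *: y i = e + \sum_(k <- r2) (e - 2 *: y k).
    have S : \sum_(k <- r2) y k = - y i by apply/eqP; rewrite -addr_eq0 addrC y0.
    rewrite sumrB -scaler_sumr S scalerN opprK addrA nn scaler_nat mulrS.
    by rewrite big_const_seq count_predT iter_addr_0.
  apply: le_trans (nmD _ _) _; rewrite /n -[leRHS]natr1 addrC lerD //.
  apply: le_trans (nm_sum _ _ _) _.
  apply: le_trans (ler_sum _ (_ : forall k, _ -> _ <= 1)) _; first by [].
  by rewrite big_const_seq count_predT iter_addr_0.
have nB : nm (n%:C%C *: e - 2 *: y i) <= n.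
  have -> : n%:C%C *: e - 2 *: y i = (size r2)%:R *: e + (e - 2 *: y i).
    by rewrite nn !scaler_nat mulrSr addrA.
  apply: le_trans (nmD _ _) _; rewrite nmZ nmc_nat /n -[leRHS]natr1 lerD //.
  by rewrite ler_piMr.
pose x := (2 / n)%:C%C *: y i.
have ys : (y i)^# = y i by rewrite !starM es pis cmulA.
have nc : n%:C%C != 0 :> R[i] by rewrite nn pnatr_eq0.
have x2 : 2 *: y i = n%:C%C *: x.
  rewrite scalerA; congr (_ *: _).
  by rewrite rmorphM /= mulrCA fmorphV mulfV ?mulr1 ?rmorph_nat.
have x0 : x = 0.
  apply: (@extreme_eq0 e) => //.
  - by rewrite /x starZ ys conjc_real.
  - by rewrite /x cmulZr /y !cmulA ee.
  - by rewrite /x cmulZl /y -!cmulA ee.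
  - move: nD; rewrite x2 -scalerDr nmZ nmc_real (ger0_norm (ltW n0)).
    by rewrite ger_pMr.
  - move: nB; rewrite x2 -scalerBr nmZ nmc_real (ger0_norm (ltW n0)).
    by rewrite ger_pMr.
(* [y i] equals [(P i ** P j)^# ** (P i ** P j)]. *)
apply: star_mul_eq0; rewrite starM es pis cmulA -(cmulA _ (P i) (P i)) pi_ -/(y i).
by apply/eqP; move: x2; rewrite x0 scaler0 => /eqP; rewrite scaler_eq0 pnatr_eq0.
Qed.

End OrthogonalProjections.

(** * Paths and Cuntz-Krieger families *)

Section GraphPaths.
Variables (L : Ngraph) (rf : row_finite L).
Implicit Types (l m : L) (v : gobj L) (n : degree).

Lemma gfactorP l (m n : degree) : gdeg l = (m `+` n)%mset ->
  exists a b, [/\ gsrc a = grng b, l = gcomp a b, gdeg a = m & gdeg b = n].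
Proof. by move=> /gfactor [[a b] [h _]]; exists a, b. Qed.

Definition path_seq v n : seq L := fset_set (paths_from v n).

Lemma path_seq_uniq v n : uniq (path_seq v n).
Proof. exact: fset_uniq. Qed.

Lemma mem_path_seq v n l : (l \in path_seq v n) = (grng l == v) && (gdeg l == n).
Proof.
rewrite /path_seq in_fset_set; last exact: rf.
apply/idP/andP => [/set_mem[-> ->]//|[/eqP lv /eqP ln]]; exact/mem_set.
Qed.

End GraphPaths.

(** * Consequences of the Cuntz-Krieger relations *)

Section CKFamily.
Variables (R : realType) (L : Ngraph) (rf : row_finite L).
Variables (A : cstarAlgType R) (u : L -> A) (hu : CK_family u).
Implicit Types (l m : L) (v : gobj L) (n : degree).

Lemma CK4_seq v n :
  u (gid v) = \sum_(l <- path_seq v n) u l ** (u l)^#.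
Proof. by rewrite (CK4 hu v n) fsbig_finite //; exact: rf. Qed.

Lemma CK_star_vertex v : (u (gid v))^# = u (gid v).
Proof. by have [] := CK1_projection hu v. Qed.

Lemma CK_src l : u l ** u (gid (gsrc l)) = u l.
Proof. by rewrite (CK2_comp hu) ?grng_id // gcomp_idr. Qed.

Lemma CK_rng l : u (gid (grng l)) ** u l = u l.
Proof. by rewrite (CK2_comp hu) ?gsrc_id // gcomp_idl. Qed.

Lemma CK_star_src l : u (gid (gsrc l)) ** (u l)^# = (u l)^#.
Proof. by rewrite -{1}CK_star_vertex -starM CK_src. Qed.

Lemma CK_star_rng l : (u l)^# ** u (gid (grng l)) = (u l)^#.
Proof. by rewrite -{1}CK_star_vertex -starM CK_rng. Qed.

Lemma CK_range_projection l : is_projection (u l ** (u l)^#).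
Proof.
by split; rewrite ?starM ?starK // cmulA (CK_partial_isometry hu).
Qed.

Lemma CK_star_partial l : (u l)^# ** u l ** (u l)^# = (u l)^#.
Proof. by rewrite -{4}(CK_partial_isometry hu l) !starM starK cmulA. Qed.

Lemma CK_mul_src_neq l m : gsrc l <> gsrc m -> u l ** (u m)^# = 0.
Proof.
by move=> h; rewrite -(CK_src l) -(CK_star_src m) cmulA -(cmulA (u l))
  (CK1_orthogonal hu h) cmul0r cmul0l.
Qed.

Lemma CK_star_mul_rng_neq l m : grng l <> grng m -> (u l)^# ** u m = 0.
Proof.
by move=> h; rewrite -(CK_rng m) -(CK_star_rng l) cmulA -(cmulA (u l)^#)
  (CK1_orthogonal hu h) cmul0r cmul0l.
Qed.

(** By (CK4) the range projections of the paths with a given range and degree add up to a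
    projection, hence are mutually orthogonal. *)
Lemma CK_star_mul l m : gdeg l = gdeg m ->
  (u l)^# ** u m = if l == m then u (gid (gsrc l)) else 0.
Proof.
move=> dlm; have [<-|lm] := eqVneq l m; first exact: CK3.
have [rlm|/eqP rlm] := eqVneq (grng l) (grng m); last exact: CK_star_mul_rng_neq.
have o : (u l ** (u l)^#) ** (u m ** (u m)^#) = 0.
  apply: (@orthogonal_of_sum _ _ _ (path_seq (grng l) (gdeg l))
    (fun k => u k ** (u k)^#) (u (gid (grng l)))) => //.
  - exact: path_seq_uniq.
  - by move=> k; exact: CK_range_projection.
  - by rewrite -CK4_seq.
  - by move=> k; rewrite mem_path_seq // => /andP[/eqP <- _]; rewrite cmulA CK_rng.
  - by rewrite mem_path_seq // !eqxx.
  - by rewrite mem_path_seq // rlm dlm !eqxx.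
rewrite -(CK_star_partial l) -[u m](CK_partial_isometry hu).
transitivity ((u l)^# ** (u l ** (u l)^# ** (u m ** (u m)^#)) ** u m).
  by rewrite !cmulA.
by rewrite o cmul0r cmul0l.
Qed.

(** Factor [m = a b] with [a] of the degree of [l]; then [(u l)^# ** u a] is a vertex projection or
    0. *)
Lemma CK_star_mul_prefix l m n : gdeg m = (gdeg l `+` n)%mset ->
  (exists k, [/\ gsrc l = grng k, m = gcomp l k & (u l)^# ** u m = u k]) \/
  (u l)^# ** u m = 0.
Proof.
move=> /gfactorP[a [b [ab -> dal _]]].
rewrite -(CK2_comp hu ab) cmulA CK_star_mul //.
have [->|_] := eqVneq l a; last by right; rewrite cmul0l.
left; exists b; split => //.
by rewrite ab CK_rng.
Qed.

(** (CK4) is inserted at the common range in degree [d(l) + d(m)], which dominates both degrees, so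
    that [CK_star_mul_prefix] applies to each factor. *)
Lemma CK_star_mul_expand l m : grng l = grng m ->
  (u l)^# ** u m = \sum_(k <- path_seq (grng l) (gdeg l `+` gdeg m)%mset)
    ((u l)^# ** u k) ** ((u m)^# ** u k)^#.
Proof.
move=> lm; rewrite -{1}(CK_star_rng l) {1}(CK4_seq _ (gdeg l `+` gdeg m)%mset).
rewrite cmul_sumr cmul_suml; apply: eq_bigr => k _.
by rewrite starM starK !cmulA.
Qed.

Lemma CK_star_mul_disjoint l m :
  (forall a b, gsrc l = grng a -> gsrc m = grng b -> gcomp l a <> gcomp m b) ->
  (u l)^# ** u m = 0.
Proof.
move=> h; have [lm|/eqP] := eqVneq (grng l) (grng m); last exact: CK_star_mul_rng_neq.
rewrite CK_star_mul_expand // big_seq big1 // => k.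
rewrite mem_path_seq // => /andP[_ /eqP dk].
have [[a [la ka _]]|->] := CK_star_mul_prefix dk; last by rewrite cmul0l.
rewrite msetDC in dk; have [[b [mb kb _]]|->] := CK_star_mul_prefix dk.
  by case: (h a b la mb); rewrite -ka -kb.
by rewrite star0 cmul0r.
Qed.

End CKFamily.

(** * Finite sums of monomials: weights, density and gauge rotations *)

Section Evaluation.
Variables (R : realType) (L : Ngraph).

(* [((c, l), m)] stands for the monomial [c s_l s_m^*]. *)
Definition entry : Type := R[i] * L * L.
Definition weight : Type := degree -> degree -> R[i].
Definition unit_weight : weight := fun _ _ => 1.

(** The weight acts on the list: a list determines its components of given degrees outright, whereas
    for the element that it represents this needs proof. *)
Definition ev (A : cstarAlgType R) (u : L -> A) (w : weight) (r : seq entry) : A :=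
  \sum_(e <- r) (w (gdeg e.1.2) (gdeg e.2) * e.1.1) *: (u e.1.2 ** (u e.2)^#).

Section Fixed.
Variables (A : cstarAlgType R) (u : L -> A).
Implicit Types (r : seq entry) (w : weight).

Lemma ev_cat w r1 r2 : ev u w (r1 ++ r2) = ev u w r1 + ev u w r2.
Proof. by rewrite /ev big_cat. Qed.

Definition entry_scale (c : R[i]) r : seq entry :=
  [seq (c * e.1.1, e.1.2, e.2) | e <- r].

Lemma ev_scale w c r : ev u w (entry_scale c r) = c *: ev u w r.
Proof.
rewrite /ev big_map scaler_sumr; apply: eq_bigr => e _ /=.
by rewrite scalerA mulrCA.
Qed.

Lemma eq_ev w w' r :
  {in r, forall e, w (gdeg e.1.2) (gdeg e.2) = w' (gdeg e.1.2) (gdeg e.2)} ->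
  ev u w r = ev u w' r.
Proof. by move=> h; apply: eq_big_seq => e /h ->. Qed.

Lemma ev_sum_weight (I : Type) (s : seq I) (c : I -> R[i]) (w : I -> weight) r :
  ev u (fun x y => \sum_(i <- s) c i * w i x y) r =
  \sum_(i <- s) c i *: ev u (w i) r.
Proof.
under [RHS]eq_bigr do rewrite scaler_sumr.
rewrite exchange_big; apply: eq_bigr => e _ /=.
rewrite mulr_suml scaler_suml; apply: eq_bigr => i _.
by rewrite scalerA mulrA.
Qed.

Lemma ev_sub_weight w w' r :
  ev u w r - ev u w' r = ev u (fun x y => w x y - w' x y) r.
Proof. by rewrite /ev -sumrB; apply: eq_bigr => e _; rewrite mulrBl scalerBl. Qed.

Definition in_span (x : A) := exists r, x = ev u unit_weight r.

Lemma in_spanD x y : in_span x -> in_span y -> in_span (x + y).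
Proof. by move=> [r ->] [r' ->]; exists (r ++ r'); rewrite ev_cat. Qed.

Lemma in_spanZ c x : in_span x -> in_span (c *: x).
Proof. by move=> [r ->]; exists (entry_scale c r); rewrite ev_scale. Qed.

Lemma in_span0 : in_span 0.
Proof. by exists [::]; rewrite /ev big_nil. Qed.

Lemma in_span_sum (I : Type) (s : seq I) (F : I -> A) :
  (forall i, in_span (F i)) -> in_span (\sum_(i <- s) F i).
Proof.
move=> h; elim: s => [|i s IH]; rewrite ?big_nil ?big_cons.
  exact: in_span0.
exact: in_spanD.
Qed.

Lemma in_span_monomial l m : in_span (u l ** (u m)^#).
Proof.
by exists [:: (1, l, m)]; rewrite /ev big_seq1 /unit_weight mulr1 scale1r.
Qed.

Lemma in_span_star x : in_span x -> in_span x^#.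
Proof.
move=> [r ->]; rewrite /ev star_sum; apply: in_span_sum => e.
by rewrite starZ starM starK; apply: in_spanZ; exact: in_span_monomial.
Qed.

Hypotheses (rf : row_finite L) (hu : CK_family u).

Lemma nm_CK l : nm (u l) <= 1.
Proof.
rewrite -(@expr_le1 _ 2) ?nm_ge0 // -nm_star_mul (CK3 hu).
exact: nm_projection (CK1_projection hu _).
Qed.

Lemma nm_ev w r (d : R) :
  {in r, forall e, nm (w (gdeg e.1.2) (gdeg e.2)) <= d} ->
  nm (ev u w r) <= d * \sum_(e <- r) nm e.1.1.
Proof.
move=> h; apply: le_trans (nm_sum _ _ _) _.
rewrite mulr_sumr !big_seq; apply: ler_sum => e er.
apply: (le_trans _ (ler_wpM2r (nm_ge0 e.1.1) (h e er))).
rewrite nmZ nmcM ler_piMr ?mulr_ge0 ?nm_ge0 //.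
by apply: le_trans (nmM _ _) _; rewrite mulr_ile1 ?nm_ge0 ?nm_star ?nm_CK.
Qed.

Lemma in_span_mul_monomial l m l' m' :
  in_span (u l ** (u m)^# ** (u l' ** (u m')^#)).
Proof.
rewrite cmulA -(cmulA (u l)).
have [ml|/eqP ml] := eqVneq (grng m) (grng l'); last first.
  by rewrite (CK_star_mul_rng_neq hu ml) cmul0r cmul0l; exact: in_span0.
rewrite (CK_star_mul_expand rf hu ml) cmul_sumr cmul_suml big_seq_cond.
rewrite big_mkcond /=; apply: in_span_sum => k; rewrite andbT.
case: ifP => [|_]; last exact: in_span0.
rewrite mem_path_seq // => /andP[_ /eqP dk].
have [[a [_ _ ->]]|->] := CK_star_mul_prefix rf hu dk; last first.
  by rewrite cmul0l cmul0r cmul0l; exact: in_span0.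
rewrite msetDC in dk; have [[b [_ _ ->]]|->] := CK_star_mul_prefix rf hu dk; last first.
  by rewrite star0 !(cmul0r, cmul0l); exact: in_span0.
have -> : u l ** (u a ** (u b)^#) ** (u m')^# = (u l ** u a) ** (u m' ** u b)^#.
  by rewrite starM !cmulA.
have [la|/eqP la] := eqVneq (gsrc l) (grng a); last first.
  by rewrite (CK2_zero hu la) cmul0l; exact: in_span0.
have [mb|/eqP mb] := eqVneq (gsrc m') (grng b); last first.
  by rewrite (CK2_zero hu mb) star0 cmul0r; exact: in_span0.
by rewrite !(CK2_comp hu) //; exact: in_span_monomial.
Qed.

Lemma in_spanM x y : in_span x -> in_span y -> in_span (x ** y).
Proof.
move=> [r ->] [r' ->]; rewrite /ev cmul_suml; apply: in_span_sum => e.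
rewrite cmul_sumr; apply: in_span_sum => e'.
by rewrite cmulZl cmulZr; do 2 apply: in_spanZ; exact: in_span_mul_monomial.
Qed.

Lemma in_span_generator l : in_span (u l).
Proof.
rewrite -(CK_src hu) -(CK_star_vertex hu); exact: in_span_monomial.
Qed.

Section Dense.
Local Open Scope classical_set_scope.

(** The closure of the span is a C*-subalgebra containing the generators, hence everything. *)
Lemma span_dense : generated_by u ->
  forall a (e : R), 0 < e -> exists r, nm (a - ev u unit_weight r) < e.
Proof.
pose S : set A := [set a | forall e : R, 0 < e -> exists2 x, in_span x & nm (a - x) < e].
have spanS x : in_span x -> S x.
  by move=> h e e0; exists x; rewrite // subrr nm0.
move=> gen a e e0.
suff : S a by move=> /(_ e e0)[_ [r ->] h]; exists r.
suff -> : S = setT by [].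
apply: gen => [|l]; last exact/spanS/in_span_generator.
split.
- move=> x clx d d0; have d2 : 0 < d / 2 by lra.
  have [] := clx (ball x (d / 2)%:C%C); first by apply: nbhsx_ballx; rewrite ltcR.
  move=> y [Sy]; rewrite -ball_normE /= nmE ltcR => xy.
  have [z zs yz] := Sy _ d2; exists z => //.
  have := nmD (x - y) (y - z); rewrite addrA subrK; lra.
- exact/spanS/in_span0.
- move=> c x y Sx Sy d d0; have d2 : 0 < d / 2 by lra.
  have c1 : 0 < nm c + 1 by have := nm_ge0 c; lra.
  have [x' x's xx'] := Sx _ (divr_gt0 d2 c1); have [y' y's yy'] := Sy _ d2.
  exists (c *: x' + y'); first by apply: in_spanD => //; exact: in_spanZ.
  rewrite opprD addrACA -scalerBr; apply: le_lt_trans (nmD _ _) _.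
  rewrite ltr_pdivlMr // in xx'; rewrite nmZ.
  by have := nm_ge0 (x - x'); nra.
- move=> x y Sx Sy d d0; have d2 : 0 < d / 2 by lra.
  have x1 : 0 < nm x + 1 by have := nm_ge0 x; lra.
  (* [y'] is chosen first, since the tolerance for [x'] depends on its norm. *)
  have [y' y's yy'] := Sy _ (divr_gt0 d2 x1).
  have y1 : 0 < nm y' + 1 by have := nm_ge0 y'; lra.
  have [x' x's xx'] := Sx _ (divr_gt0 d2 y1).
  exists (x' ** y'); first exact: in_spanM.
  have -> : x ** y - x' ** y' = x ** (y - y') + (x - x') ** y'.
    by rewrite cmulBl cmulBr addrA subrK.
  rewrite ltr_pdivlMr // in xx'; rewrite ltr_pdivlMr // in yy'.
  have := nmD (x ** (y - y')) ((x - x') ** y').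
  have := nmM x (y - y'); have := nmM (x - x') y'.
  have := nm_ge0 (x - x'); have := nm_ge0 (y - y'); nra.
- move=> x Sx d d0; have [x' x's xx'] := Sx _ d0.
  by exists x'^#; [exact: in_span_star|rewrite -starB nm_star].
Qed.

End Dense.
End Fixed.

Lemma ev_morphism (A B : cstarAlgType R) (u : L -> A) (t : L -> B) (f : {linear A -> B})
    w r : star_morphism f -> (forall l, f (u l) = t l) -> f (ev u w r) = ev t w r.
Proof.
move=> [fM fs] fu; rewrite linear_sum; apply: eq_bigr => e _.
by rewrite linearZ fM fs !fu.
Qed.

Definition is_character (chi : degree -> R[i]) :=
  (forall n, nm (chi n) = 1) /\ forall m n, chi (m `+` n)%mset = chi m * chi n.

Lemma characterJ chi n : is_character chi -> chi n * conjc (chi n) = 1.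
Proof. by move=> [h _]; rewrite mulcJ h expr1n. Qed.

Lemma character0 chi : is_character chi -> chi mset0 = 1.
Proof.
move=> h; have [_ hD] := h.
by rewrite -[LHS]mulr1 -(characterJ mset0 h) mulrA -hD mset0D characterJ.
Qed.

Lemma CK_family_rotate (A : cstarAlgType R) (u : L -> A) chi :
  is_character chi -> CK_family u -> CK_family (fun l => chi (gdeg l) *: u l).
Proof.
move=> hc hu; have [_ hD] := hc.
have cc n : conjc (chi n) * chi n = 1 by rewrite mulrC characterJ.
have v1 v : chi (gdeg (gid v)) *: u (gid v) = u (gid v).
  by rewrite gdeg_id character0 // scale1r.
split.
- move=> l; rewrite /partial_isometry starZ !cmulZl !cmulZr !scalerA.
  by rewrite cmulZl scalerA -mulrA characterJ // mulr1 (CK_partial_isometry hu).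
- by move=> v; rewrite v1; exact: CK1_projection hu v.
- by move=> v w vw; rewrite !v1 (CK1_orthogonal hu).
- move=> l m lm; rewrite cmulZl cmulZr scalerA (CK2_comp hu) //.
  by rewrite gdeg_comp // hD.
- by move=> l m lm; rewrite cmulZl cmulZr (CK2_zero hu) // !scaler0.
- by move=> l; rewrite v1 starZ cmulZl cmulZr scalerA cc scale1r (CK3 hu).
- move=> v n; rewrite v1 (CK4 hu v n); apply: eq_fsbigr => l _.
  by rewrite starZ cmulZl cmulZr scalerA characterJ // scale1r.
Qed.

(** The endomorphism [s_l |-> chi(d(l)) s_l] multiplies a monomial of degrees [x], [y] by
    [chi x * conjc (chi y)], and it is contractive. *)
Lemma nm_ev_rotate (A : cstarAlgType R) (s : L -> A) chi r :
  universal_CK_family s -> is_character chi ->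
  nm (ev s (fun x y => chi x * conjc (chi y)) r) <= nm (ev s unit_weight r).
Proof.
move=> hs hc; have [f fm fu] := universal_lift hs (CK_family_rotate hc (universal_CK hs)).
apply: le_trans (nm_star_morphism fm _).
rewrite (ev_morphism _ _ fm fu) le_eqVlt; apply/orP; left; apply/eqP; congr nm.
apply: eq_bigr => e _; rewrite starZ cmulZl cmulZr !scalerA /unit_weight mul1r.
by congr (_ *: _); rewrite mulrC mulrA.
Qed.

End Evaluation.

(** * Aperiodicity and compression to matrix units *)

Section Separation.
Variable L : Ngraph.
Implicit Types (l m : L) (v : gobj L).

Definition disjoint_extensions l m := forall a b,
  gsrc l = grng a -> gsrc m = grng b -> gcomp l a <> gcomp m b.

(** The form in which aperiodicity is used: [t_{a k}] and [t_{b k}] get orthogonal ranges for all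
    [a], [b] of the degrees [m], [n]. *)
Definition separates (k : L) (m n : degree) := forall a b : L,
  gsrc a = grng k -> gsrc b = grng k -> gdeg a = m -> gdeg b = n ->
  disjoint_extensions (gcomp a k) (gcomp b k).

Lemma is_segment_extend (a k b x : L) (p q : degree) :
  gsrc a = grng k -> gsrc k = grng b -> is_segment k p q x ->
  is_segment (gcomp (gcomp a k) b) (gdeg a `+` p)%mset (gdeg a `+` q)%mset x.
Proof.
move=> ak kb [k' [k'' [k'x xk'' e dk' dx]]].
have xk : gsrc k' = grng (gcomp x k'') by rewrite grng_comp.
have ak' : gsrc a = grng k' by rewrite ak e grng_comp.
have k''b : gsrc k'' = grng b by rewrite -kb e !gsrc_comp.
exists (gcomp a k'), (gcomp k'' b); split.
- by rewrite gsrc_comp.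
- by rewrite grng_comp.
- rewrite {1}e -[RHS]gcompA ?gsrc_comp ?grng_comp // -[LHS]gcompA ?gsrc_comp ?grng_comp //.
  congr gcomp; rewrite -gcompA ?gsrc_comp ?grng_comp //; congr gcomp.
  by rewrite gcompA.
- by rewrite gdeg_comp // dk'.
- by rewrite dx msetBDl.
Qed.

(* In a common extension [a k a' = b k b'], both segments of [k] compared by
   aperiodicity sit at the positions between [m + n] and [m + n + D], where
   [D = d(k) - (m \/ n)]; so they would be equal. *)
Lemma aperiodic_separates : aperiodic L -> forall v (m n : degree), m <> n ->
  exists2 k, grng k = v & separates k m n.
Proof.
move=> ap v m n mn; have [k [kv mnk seg]] := ap v m n mn.
exists k => // a b ak bk da db a' b' aka' bkb' e; apply: seg.
rewrite !gsrc_comp // in aka' bkb'.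
set q1 := (_ `\` _)%mset; set q2 := (_ `\` _)%mset.
have pt i : (maxn (m i) (n i) <= gdeg k i)%N.
  by have := msubsetP mnk i; rewrite msetE2.
have s1 : is_segment k m q1 (segment k m q1).
  by apply: segmentP; apply/msubsetP => i; rewrite !msetE2; have := pt i; lia.
have s2 : is_segment k n q2 (segment k n q2).
  by apply: segmentP; apply/msubsetP => i; rewrite !msetE2; have := pt i; lia.
(* The segment of [k] at [m] is read in [b k b'] and the one at [n] in [a k a']: both then start at
   [m + n]. *)
have t1 := is_segment_extend bk bkb' s1; have t2 := is_segment_extend ak aka' s2.
rewrite e da in t2; rewrite db in t1.
have e1 : (n `+` m = m `+` n)%mset by rewrite msetDC.
have e2 : (n `+` q1 = m `+` q2)%mset.
  by apply/msetP => i; rewrite !msetE2; have := pt i; lia.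
by rewrite e1 e2 in t1; exact: is_segment_inj t1 t2.
Qed.

(** The pairs are treated one by one: [k] is prolonged by a [k'] separating [m + d(k)] from
    [n + d(k)]. Earlier separations survive, as an extension of [a k k'] is one of [a k]. *)
Lemma aperiodic_separates_seq : aperiodic L -> forall v (D : seq (degree * degree)),
  (forall d, d \in D -> d.1 <> d.2) ->
  exists2 k, grng k = v & forall d, d \in D -> separates k d.1 d.2.
Proof.
move=> ap v; elim=> [|[m n] D IH] hD; first by exists (gid v); rewrite ?grng_id.
have [|k kv kD] := IH; first by move=> d dD; apply: hD; rewrite inE dD orbT.
have mn : (m `+` gdeg k <> n `+` gdeg k)%mset.
  move=> h; apply: (hD (m, n)); first by rewrite inE eqxx.
  by rewrite /= -(msetDKBC (gdeg k) m) h msetDKBC.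
have [k' kk' k'mn] := aperiodic_separates ap (gsrc k) mn.
exists (gcomp k k'); first by rewrite grng_comp.
move=> d; rewrite inE => /predU1P[-> /=|dD] a b.
  rewrite grng_comp // => ak bk da db; rewrite !gcompA //.
  by apply: k'mn; rewrite ?gsrc_comp ?gdeg_comp ?da ?db.
rewrite grng_comp // => ak bk da db a' b'; rewrite !gsrc_comp ?grng_comp // => ka' kb'.
rewrite !gcompA // -!(gcompA _ ka') -?(gcompA _ kb') ?gsrc_comp //.
by apply: (kD d dD) => //; rewrite gsrc_comp ?grng_comp.
Qed.

End Separation.

(** * Sums of matrix units and their norms *)

Section MatrixUnits.
Variables (R : realType) (L : Ngraph).
Implicit Types (F G H : seq L) (C D : L -> L -> R[i]).

Section Algebra.
Variable A : cstarAlgType R.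
Implicit Types (u y z : L -> A) (f : gobj L -> A).

Definition matrix_sum u y C F G : A :=
  \sum_(i <- F) \sum_(j <- G) C i j *: (u i ** (y j)^#).

(** Makes the products [y i ** (y j)^#] with equal sources multiply as matrix units; [f] stands for
    the vertex projections. *)
Definition orthonormal_family y f G :=
  {in G &, forall i j, (y i)^# ** y j = if i == j then f (gsrc i) else 0} /\
  (forall j, y j ** f (gsrc j) = y j).

Definition source_diagonal C := forall i j, C i j != 0 -> gsrc i = gsrc j.

Definition matrix_mul C D G i k := \sum_(j <- G) C i j * D j k.
Definition matrix_adj C i j := conjc (C j i).

Lemma matrix_sum_star u y C F G :
  (matrix_sum u y C F G)^# = matrix_sum y u (matrix_adj C) G F.
Proof.
rewrite /matrix_sum star_sum [RHS]exchange_big; apply: eq_bigr => i _ /=.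
by rewrite star_sum; apply: eq_bigr => j _; rewrite starZ starM starK.
Qed.

Lemma matrix_sum_mul u y z f C D F G H : uniq G -> orthonormal_family y f G ->
  source_diagonal C -> (forall j, u j ** f (gsrc j) = u j) ->
  matrix_sum u y C F G ** matrix_sum y z D G H =
  matrix_sum u z (matrix_mul C D G) F H.
Proof.
move=> uG [yy yf] dC uf; rewrite /matrix_sum cmul_suml; apply: eq_bigr => i _.
rewrite cmul_suml.
transitivity (\sum_(j <- G) \sum_(k <- H) (C i j * D j k) *: (u i ** (z k)^#)).
  apply: eq_big_seq => j jG; rewrite cmul_sumr (bigD1_seq j) //= [X in _ + X]big1_seq ?addr0.
    rewrite cmul_sumr; apply: eq_bigr => k _.
    rewrite cmulZl cmulZr scalerA cmulA -(cmulA (u i)) yy // eqxx.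
    (* A nonzero coefficient forces equal sources, and then [u i] absorbs [f (gsrc j)]. *)
    have [->|/dC cij] := eqVneq (C i j) 0; first by rewrite !mul0r !scale0r.
    by rewrite -cij uf.
  move=> j' /andP[j'j j'G]; rewrite cmul_sumr big1 // => k _.
  rewrite cmulZl cmulZr cmulA -(cmulA (u i)) yy // eq_sym (negPf j'j).
  by rewrite cmul0r cmul0l !scaler0.
rewrite exchange_big; apply: eq_bigr => k _ /=.
by rewrite -scaler_suml.
Qed.

(* [gram_power C F G n] is the power [2 ^ n] of [C^* C]. *)
Fixpoint gram_power C F G n :=
  if n is n'.+1 then matrix_mul (gram_power C F G n') (gram_power C F G n') G
  else matrix_mul (matrix_adj C) C F.

Lemma gram_power_diagonal C F G n : source_diagonal C ->
  source_diagonal (gram_power C F G n).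
Proof.
have md X Y Z : source_diagonal X -> source_diagonal Y ->
    source_diagonal (matrix_mul X Y Z).
  move=> dX dY i k; have [->//|ik] := eqVneq (gsrc i) (gsrc k).
  rewrite /matrix_mul big1 ?eqxx // => j _.
  have [->|/dX ij] := eqVneq (X i j) 0; first by rewrite mul0r.
  have [->|/dY jk] := eqVneq (Y j k) 0; first by rewrite mulr0.
  by rewrite ij jk eqxx in ik.
move=> dC; elim: n => [|n IH] /=; apply: md => //.
by move=> i j; rewrite /matrix_adj conjc_eq0 => /dC.
Qed.

Lemma gram_power_adj C F G n i j :
  conjc (gram_power C F G n i j) = gram_power C F G n j i.
Proof.
elim: n i j => [|n IH] i j /=; rewrite /matrix_mul rmorph_sum;
  apply: eq_bigr => k _; rewrite rmorphM mulrC /=.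
  by rewrite /matrix_adj conjcK.
by rewrite !IH.
Qed.

(** The C*-identity gives the first exponent; the Gram sums are self-adjoint, so each further
    squaring squares the norm. *)
Lemma nm_matrix_sum_power u y f C F G n : uniq F -> uniq G ->
  orthonormal_family u f F -> orthonormal_family y f G -> source_diagonal C ->
  nm (matrix_sum u y C F G) ^+ (2 ^ n.+1) =
  nm (matrix_sum y y (gram_power C F G n) G G).
Proof.
move=> uF uG ou oy dC; elim: n => [|n IH].
  rewrite expn1 -nm_star_mul matrix_sum_star (matrix_sum_mul _ _ _ _ uF ou) //.
    by move=> i j; rewrite /matrix_adj conjc_eq0 => /dC.
  exact: oy.2.
rewrite expnSr exprM IH -nm_self_adjoint; last first.
  rewrite matrix_sum_star; apply: eq_bigr => i _; apply: eq_bigr => j _.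
  by rewrite /matrix_adj gram_power_adj.
rewrite (matrix_sum_mul _ _ _ _ uG oy) //; last exact: oy.2.
exact: gram_power_diagonal.
Qed.

End Algebra.

(** If [0 < b < x], Bernoulli's inequality makes the powers of [x / b] outgrow [c]. *)
Lemma le_of_power_le (x b c : R) : 0 <= x -> 0 <= b ->
  (forall n, x ^+ (2 ^ n.+1) <= c * b ^+ (2 ^ n.+1)) -> x <= b.
Proof.
move=> x0 b0 h; rewrite leNgt; apply/negP => bx.
have [b00|bn0] := eqVneq b 0.
  have := h 0%N; rewrite b00 expn1 expr0n mulr0 expr2; nra.
have bp : 0 < b by rewrite lt_neqAle eq_sym bn0.
pose d := x / b - 1.
have d0 : 0 < d by rewrite subr_gt0 ltr_pdivlMr // mul1r.
have bern N : 1 + N%:R * d <= (1 + d) ^+ N.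
  elim: N => [|N IH]; first by rewrite mul0r addr0.
  rewrite exprS -natr1.
  have : 0 <= N%:R * d by rewrite mulr_ge0 // ltW.
  have := ler_wpM2l (_ : 0 <= 1 + d) IH => /(_ ltac:(lra)); nra.
have hc n : (2 ^ n.+1)%:R * d <= c.
  have := h n; rewrite -ler_pdivrMr ?exprn_gt0 // -expr_div_n.
  have -> : x / b = 1 + d by rewrite /d addrC subrK.
  by have := bern (2 ^ n.+1)%N; lra.
have cd : c / d < (Num.bound (c / d))%:R.
  apply: archi_boundP; rewrite divr_ge0 ?(ltW d0) // (le_trans _ (hc 0%N)) //.
  by rewrite mulr_ge0 // ltW.
have : (Num.bound (c / d))%:R <= (2 ^ (Num.bound (c / d)).+1)%:R :> R.
  by rewrite ler_nat ltnW // (ltn_trans (ltnSn _)) // ltn_expl.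
have := hc (Num.bound (c / d)); rewrite -ler_pdivlMr //; lra.
Qed.

End MatrixUnits.

(** * Compression by projections at a separating path *)

Section Compression.
Variables (R : realType) (L : Ngraph) (rf : row_finite L).
Local Notation entry := (entry R L).
Implicit Types (r : seq entry).

(** Such a weight gives [s_l s_m^#] and its extensions [s_{l k} s_{m k}^#] the same value. *)
Definition invariant_weight (w : weight R) :=
  forall x y k, w (x `+` k)%mset (y `+` k)%mset = w x y.

(** (CK4) at the source of [l], in degree [M - d(l)], rewrites each monomial; monomials with
    different sources vanish and are dropped. *)
Lemma ev_extend (A : cstarAlgType R) (u : L -> A) r (M : degree) : CK_family u ->
  (forall e, e \in r -> (gdeg e.1.2 `<=` M)%mset) ->
  exists r' : seq entry,
    (forall e, e \in r' -> gdeg e.1.2 = M /\ gsrc e.1.2 = gsrc e.2) /\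
    (forall w, invariant_weight w -> ev u w r = ev u w r').
Proof.
move=> hu; elim: r => [|[[c l] m] r IH] hr; first by exists [::].
have [|r' [h1 h2]] := IH; first by move=> e er; apply: hr; rewrite inE er orbT.
have [lm|/eqP lm] := eqVneq (gsrc l) (gsrc m); last first.
  exists r'; split=> // w wi; rewrite -h2 // /ev big_cons /=.
  by rewrite (CK_mul_src_neq hu lm) scaler0 add0r.
have lM : (gdeg l `<=` M)%mset by apply: (hr (c, l, m)); rewrite inE eqxx.
set K := path_seq (gsrc l) (M `\` gdeg l)%mset.
have KP k : k \in K -> [/\ gsrc l = grng k, gsrc m = grng k & gdeg k = (M `\` gdeg l)%mset].
  by rewrite mem_path_seq // -lm => /andP[/eqP -> /eqP ->].
exists ([seq (c, gcomp l k, gcomp m k) | k <- K] ++ r'); split.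
  move=> e; rewrite mem_cat => /orP[/mapP[k /KP[lk mk dk] ->]|/h1//] /=.
  by rewrite !gsrc_comp // gdeg_comp // dk msetBDKC.
move=> w wi; rewrite ev_cat -h2 // /ev big_cons /=; congr (_ + _).
rewrite big_map -{1}(CK_src hu l) (CK4_seq rf hu _ (M `\` gdeg l)%mset) -/K.
rewrite cmul_sumr cmul_suml scaler_sumr; apply: eq_big_seq => k /KP[lk mk dk] /=.
rewrite !gdeg_comp // wi; congr (_ *: _).
by rewrite -!(CK2_comp hu) // starM !cmulA.
Qed.

Section Fixed.
Variables (A B : cstarAlgType R) (s : L -> A) (t : L -> B).
Hypotheses (hs : CK_family s) (ht : CK_family t).
Hypotheses (ap : aperiodic L) (t0 : forall v, t (gid v) <> 0).

Variables (r : seq entry) (M M' : degree).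
Hypothesis (rM : forall e, e \in r -> gdeg e.1.2 = M /\ gsrc e.1.2 = gsrc e.2).

(** Rows, columns and coefficients of the terms whose second path has degree [M']; repeated
    monomials are merged in [C]. *)
Let F := undup [seq e.1.2 | e <- r].
Let G := undup [seq e.2 | e <- r & gdeg e.2 == M'].
Let C (i j : L) : R[i] := \sum_(e <- r | (e.1.2 == i) && (e.2 == j)) e.1.1.

Let FM i : i \in F -> gdeg i = M.
Proof. by rewrite mem_undup => /mapP[e /rM[eM _] ->]. Qed.

Let GM j : j \in G -> gdeg j = M'.
Proof.
by rewrite mem_undup => /mapP[e]; rewrite mem_filter => /andP[/eqP h _] ->.
Qed.

Let diagC : source_diagonal C.
Proof.
move=> i j; have [->//|ij] := eqVneq (gsrc i) (gsrc j).
rewrite /C big1_seq ?eqxx // => e /andP[/andP[/eqP ei /eqP ej] /rM[_ h]].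
by move: ij; rewrite -ei -ej h eqxx.
Qed.

Let ev_matrix_sum : ev s (fun _ y => (y == M')%:R) r = matrix_sum s s C F G.
Proof.
rewrite /matrix_sum /C.
transitivity (\sum_(e <- r) \sum_(i <- F) \sum_(j <- G)
    (if (e.1.2 == i) && (e.2 == j) then e.1.1 else 0) *: (s i ** (s j)^#)).
  apply: eq_big_seq => e er; rewrite (bigD1_seq e.1.2) ?undup_uniq //=; last first.
    by rewrite mem_undup; apply/mapP; exists e.
  rewrite [X in _ + X]big1 ?addr0 => [|i ie]; last first.
    by rewrite big1 // => j _; rewrite eq_sym (negPf ie) scale0r.
  have [eM'|eM'] := eqVneq (gdeg e.2) M'.
    rewrite (bigD1_seq e.2) ?undup_uniq //=; last first.
      by rewrite mem_undup; apply/mapP; exists e; rewrite // mem_filter eM' eqxx.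
    rewrite !eqxx mul1r [X in _ + X]big1 ?addr0 // => j je.
    by rewrite eq_sym (negPf je) andbF scale0r.
  rewrite mul0r scale0r big1_seq // => j /andP[_ jG].
  have [ej|_] := eqVneq e.2 j; last by rewrite andbF scale0r.
  by rewrite ej (GM jG) eqxx in eM'.
rewrite exchange_big; apply: eq_bigr => i _ /=.
rewrite exchange_big; apply: eq_bigr => j _ /=.
by rewrite [in RHS]big_mkcond scaler_suml.
Qed.

Let ortho_s (H : seq L) (N : degree) : (forall j, j \in H -> gdeg j = N) ->
  orthonormal_family s (fun v => s (gid v)) H.
Proof.
move=> HN; split=> [i j iH jH|j]; last exact: CK_src.
by rewrite (CK_star_mul rf hs) // !HN.
Qed.

Section Vertex.
Variables (v : gobj L) (k : L).
Hypotheses (kv : grng k = v).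
Hypothesis (ksep : forall e, e \in r -> gdeg e.2 <> M' -> separates k (gdeg e.2) M').

(** The value 0 at sources other than [v] lets the compression keep the index lists [F], [G] and the
    coefficients [C]. *)
Let tw (i : L) : B := if gsrc i == v then t i ** t k else 0.
Let f (w : gobj L) : B := if w == v then t (gid (gsrc k)) else 0.

Let nm_tw i : nm (tw i) <= 1.
Proof.
rewrite /tw; case: ifP => _; last by rewrite nm0.
by apply: le_trans (nmM _ _) _; rewrite mulr_ile1 ?nm_ge0 ?nm_CK.
Qed.

Let ortho_t (H : seq L) (N : degree) : (forall j, j \in H -> gdeg j = N) ->
  orthonormal_family tw f H.
Proof.
move=> HN; split=> [i j iH jH|j]; rewrite /tw /f.
  case: ifP => [/eqP iv|iv]; last by rewrite star0 cmul0l; case: ifP.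
  case: (eqVneq (gsrc j) v) => jv; last first.
    rewrite cmul0r; case: eqVneq => // ij; by rewrite -ij iv eqxx in jv.
  rewrite starM cmulA -(cmulA _ (t i)^#) (CK_star_mul rf ht) ?HN //.
  case: ifP => _; last by rewrite cmul0r cmul0l.
  by rewrite iv -kv (CK_star_rng ht) (CK3 ht).
case: ifP => _; last by rewrite cmul0l.
by rewrite -cmulA (CK_src ht).
Qed.

Let range_projection (H : seq L) (N : degree) :
    uniq H -> (forall j, j \in H -> gdeg j = N) ->
  nm (\sum_(j <- H) tw j ** (tw j)^#) <= 1.
Proof.
move=> uH HN; have [h1 h2] := ortho_t HN.
apply: nm_projection; split; last first.
  by rewrite star_sum; apply: eq_bigr => j _; rewrite starM starK.
rewrite cmul_suml; apply: eq_big_seq => j jH; rewrite cmul_sumr.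
rewrite (bigD1_seq j) //= [X in _ + X]big1_seq ?addr0.
  by rewrite cmulA -(cmulA (tw j)) h1 // eqxx h2.
move=> i /andP[ij iH]; rewrite cmulA -(cmulA (tw j)) h1 // eq_sym (negPf ij).
by rewrite cmul0r cmul0l.
Qed.

(* An entry whose second path has degree different from [M'] is annihilated because
   [k] separates the two degrees. *)
Let corner i j : i \in F -> j \in G ->
  tw i ** (tw i)^# ** ev t (@unit_weight R) r ** (tw j ** (tw j)^#) =
  C i j *: (tw i ** (tw j)^#).
Proof.
move=> iF jG.
rewrite {1 2 3 4}/tw; case: ifP => [/eqP iv|iv]; last first.
  by rewrite /tw iv !cmul0l scaler0.
case: ifP => [/eqP jv|jv]; last by rewrite {2}/tw jv star0 !cmul0r scaler0.
rewrite {1 2}/tw iv jv eqxx.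
suff E : (t i ** t k)^# ** ev t (@unit_weight R) r ** (t j ** t k) =
         C i j *: t (gid (gsrc k)).
  transitivity (t i ** t k ** ((t i ** t k)^# ** ev t (@unit_weight R) r ** (t j ** t k))
    ** (t j ** t k)^#); first by rewrite !cmulA.
  by rewrite E cmulZr cmulZl -(cmulA (t i)) (CK_src ht).
rewrite /ev cmul_sumr cmul_suml /C [in RHS]big_mkcond scaler_suml.
apply: eq_big_seq => e er; have [eM esrc] := rM er.
rewrite cmulZr cmulZl /unit_weight mul1r starM.
have -> : (t k)^# ** (t i)^# ** (t e.1.2 ** (t e.2)^#) ** (t j ** t k) =
  (t k)^# ** ((t i)^# ** t e.1.2) ** (t e.2)^# ** t j ** t k by rewrite !cmulA.
rewrite (CK_star_mul rf ht) ?eM ?FM // [e.1.2 == i]eq_sym.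
have [ie|_] := eqVneq i e.1.2; last by rewrite cmul0r !cmul0l scaler0 scale0r.
rewrite iv -kv (CK_star_rng ht) /=.
have [eM'|eM'] := eqVneq (gdeg e.2) M'.
  rewrite -(cmulA (t k)^#) (CK_star_mul rf ht) ?eM' ?GM //.
  have [ej|_] := eqVneq e.2 j; last by rewrite cmul0r cmul0l scaler0 scale0r.
  by rewrite ej jv -kv (CK_star_rng ht) (CK3 ht).
have -> /= : (e.2 == j) = false.
  by apply: contraNF eM' => /eqP ->; rewrite GM.
have ev' : gsrc e.2 = v by rewrite -esrc -ie.
have -> : (t k)^# ** (t e.2)^# ** t j ** t k = (t e.2 ** t k)^# ** (t j ** t k).
  by rewrite starM !cmulA.
rewrite !(CK2_comp ht) ?ev' ?jv // CK_star_mul_disjoint ?scaler0 ?scale0r //.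
by apply: (ksep er (elimN eqP eM')) => //; rewrite ?ev' ?jv ?kv ?GM.
Qed.

(** By [corner], the matrix sum is [ev t] cut down on both sides by sums of orthogonal range
    projections, of norm at most 1. *)
Lemma compression : nm (matrix_sum tw tw C F G) <= nm (ev t (@unit_weight R) r).
Proof.
have -> : matrix_sum tw tw C F G = (\sum_(i <- F) tw i ** (tw i)^#) **
    ev t (@unit_weight R) r ** (\sum_(j <- G) tw j ** (tw j)^#).
  rewrite !cmul_suml; apply: eq_big_seq => i iF.
  rewrite cmul_sumr; apply: eq_big_seq => j jG.
  by rewrite corner.
have QF := range_projection (undup_uniq _) FM.
have QG := range_projection (undup_uniq _) GM.
apply: le_trans (nmM _ _) _; rewrite -[leRHS]mulr1.
apply: ler_pM; rewrite ?nm_ge0 //.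
by apply: le_trans (nmM _ _) _; rewrite ler_piMl ?nm_ge0.
Qed.

(** Multiplying by [(tw i)^#] and [tw j] isolates the coefficient times [t (gid (gsrc k))], a
    projection of norm 1 because it is nonzero. *)
Lemma nm_gram_power n i j : i \in G -> j \in G -> gsrc i = v -> gsrc j = v ->
  nm (gram_power C F G n i j) <= nm (ev t (@unit_weight R) r) ^+ (2 ^ n.+1).
Proof.
move=> iG jG iv jv; have [h1 h2] := ortho_t GM.
have := nm_matrix_sum_power n (undup_uniq _) (undup_uniq _)
  (ortho_t FM) (ortho_t GM) diagC.
rewrite -/F -/G => E.
have := compression; rewrite -(@ler_pXn2r _ (2 ^ n.+1)) ?nnegrE ?nm_ge0 ?expn_gt0 //.
rewrite E; apply: le_trans.
set g := gram_power C F G n.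
have -> : nm (g i j) = nm ((tw i)^# ** matrix_sum tw tw g G G ** tw j).
  have -> : (tw i)^# ** matrix_sum tw tw g G G ** tw j = g i j *: t (gid (gsrc k)).
    rewrite cmul_sumr cmul_suml (bigD1_seq i) ?undup_uniq //= [X in _ + X]big1_seq.
      rewrite addr0 cmul_sumr cmul_suml (bigD1_seq j) ?undup_uniq //=.
      rewrite [X in _ + X]big1_seq ?addr0.
        rewrite cmulZr cmulZl !cmulA -(cmulA ((tw i)^# ** _)) !h1 // !eqxx.
        by rewrite /f iv jv eqxx; have [-> _] := CK1_projection ht (gsrc k).
      move=> j' /andP[jj' j'G]; rewrite cmulZr cmulZl !cmulA -(cmulA ((tw i)^# ** _)).
      by rewrite (h1 j' j) // (negPf jj') cmul0r scaler0.
    move=> i' /andP[ii' i'G]; rewrite cmul_sumr cmul_suml big1 // => j' _.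
    rewrite cmulZr cmulZl !cmulA (h1 i i') // eq_sym (negPf ii').
    by rewrite !cmul0l scaler0.
  by rewrite nmZ (nm_projection1 (CK1_projection ht _)) // mulr1.
apply: le_trans (nmM _ _) _; rewrite -[leRHS]mulr1; apply: ler_pM; rewrite ?nm_ge0 //.
by apply: le_trans (nmM _ _) _; rewrite ler_piMl ?nm_ge0 // nm_star nm_tw.
Qed.

End Vertex.

(* Each coefficient of a power of [X^* X] is bounded through the compression at one
   vertex.  The number of coefficients does not depend on the power, so it
   disappears when roots are taken. *)
Lemma nm_ev_fixed_degree :
  nm (ev s (fun _ y => (y == M')%:R) r) <= nm (ev t (@unit_weight R) r).
Proof.
rewrite ev_matrix_sum.
apply: (@le_of_power_le _ _ _ (\sum_(i <- G) \sum_(j <- G) 1)); rewrite ?nm_ge0 // => n.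
rewrite (nm_matrix_sum_power n (undup_uniq _) (undup_uniq _)
  (ortho_s FM) (ortho_s GM) diagC) -/F -/G.
apply: le_trans (nm_sum _ _ _) _; rewrite mulr_suml !big_seq.
apply: ler_sum => i iG; apply: le_trans (nm_sum _ _ _) _.
rewrite mulr_suml !big_seq; apply: ler_sum => j jG; rewrite mul1r nmZ.
apply: (@le_trans _ _ (nm (gram_power C F G n i j))).
  rewrite ler_piMr ?nm_ge0 //; apply: le_trans (nmM _ _) _.
  by rewrite nm_star mulr_ile1 ?nm_ge0 ?nm_CK.
have [ij|ij] := eqVneq (gsrc i) (gsrc j); last first.
  have -> : gram_power C F G n i j = 0.
    by apply/eqP; apply: contraTT ij => /(gram_power_diagonal diagC) ->; rewrite negbK.
  by rewrite nm0 exprn_ge0 ?nm_ge0.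
(* One [k] with range the common source separates [M'] from all other degrees of second paths in
   [r]. *)
have [|k kv kD] := aperiodic_separates_seq ap (gsrc i)
  (D := [seq (gdeg e.2, M') | e <- r & gdeg e.2 != M']).
  by move=> d /mapP[e]; rewrite mem_filter => /andP[/eqP h _ ->].
apply: (nm_gram_power kv) => // e er eM'.
apply: (kD (gdeg e.2, M')); apply/mapP; exists e => //.
by rewrite mem_filter er andbT; apply/eqP.
Qed.

End Fixed.

Definition shift_weight (p q : degree) : weight R :=
  fun x y => ((p `+` x)%mset == (q `+` y)%mset)%:R.

Lemma nm_ev_shift (A B : cstarAlgType R) (s : L -> A) (t : L -> B) (pi : {linear A -> B})
    (p q : degree) r :
  CK_family s -> CK_family t -> aperiodic L -> (forall v, t (gid v) <> 0) ->
  star_morphism pi -> (forall l, pi (s l) = t l) ->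
  nm (ev s (shift_weight p q) r) <= nm (ev t (@unit_weight R) r).
Proof.
move=> hs ht ap t0 pim pis.
(* [M0] dominates [q] too, so that [p + M0 = q + y] is solved by [y = p + (M0 - q)] and only the
   second degree is constrained. *)
have [M0 [qM0 rM0]] : exists M0 : degree, (q `<=` M0)%mset /\
    forall e, e \in r -> (gdeg e.1.2 `<=` M0)%mset.
  elim: r => [|e r' [M [qM rM]]]; first by exists q; split=> //; exact: msubset_refl.
  exists (gdeg e.1.2 `|` M)%mset; split; first by rewrite msubsetU // qM orbT.
  move=> e'; rewrite inE => /predU1P[->|/rM h]; first exact: msubsetUl.
  by rewrite msubsetU // h orbT.
have [r' [r'P r'E]] := ev_extend hs rM0.
have si : invariant_weight (shift_weight p q).
  move=> x y k; rewrite /shift_weight !msetDA; congr (nat_of_bool _)%:R.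
  by apply/eqP/eqP => [|->//] /(congr1 (msetB^~ k)); rewrite !msetDKBC.
(* [r'] was obtained for [s]; [pi] carries the equality of sums over to [t]. *)
rewrite -(ev_morphism _ _ pim pis) !r'E // (ev_morphism _ _ pim pis).
apply: le_trans (nm_ev_fixed_degree hs ht ap t0 (p `+` (M0 `\` q))%mset r'P).
rewrite le_eqVlt; apply/orP; left; apply/eqP; congr nm; apply: eq_ev => e er.
have [-> _] := r'P e er; rewrite /shift_weight; congr (nat_of_bool _)%:R.
rewrite -{1}(msetBDKC qM0) msetDCA.
apply/eqP/eqP => [/(congr1 (msetB^~ q))|->//].
by rewrite ![(q `+` _)%mset]msetDC !msetDKBC.
Qed.

End Compression.

(** * Gauge averages over boxes of degrees *)

Section Degrees.
Implicit Types (x y : degree).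

Lemma degree_bound (r : seq degree) : exists T, forall x, x \in r ->
  forall i, (x i < T)%N /\ ((T <= i)%N -> x i = 0%N).
Proof.
elim: r => [|x r [T hT]]; first by exists 0%N.
pose S := (\sum_(i <- finsupp x) (i + x i)%N)%N.+1.
have hS i : (x i < S)%N /\ ((S <= i)%N -> x i = 0%N).
  have [ix|ix] := boolP (i \in finsupp x); last by rewrite fsfun_dflt.
  have : (i + x i < S)%N by rewrite ltnS (big_rem i) //= leq_addr.
  by lia.
exists (maxn S T) => y; rewrite inE => /predU1P[->|yr] i.
  by have [h1 h2] := hS i; split=> [|h]; [|apply: h2]; lia.
by have [h1 h2] := hT y yr i; split=> [|h]; [|apply: h2]; lia.
Qed.

(** The entries read as digits in base [b]: additive in the degree, and injective on degrees with
    entries below [b] and support below [k]. *)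
Definition degree_weight (b k : nat) x := (\sum_(i < k) x i * b ^ i)%N.

Lemma degree_weightD b k x y :
  degree_weight b k (x `+` y)%mset = (degree_weight b k x + degree_weight b k y)%N.
Proof.
by rewrite -big_split; apply: eq_bigr => i _; rewrite msetE2 mulnDl.
Qed.

Lemma digits_inj (b k : nat) (f g : nat -> nat) :
  (forall i, f i < b)%N -> (forall i, g i < b)%N ->
  (\sum_(i < k) f i * b ^ i = \sum_(i < k) g i * b ^ i)%N ->
  forall i, (i < k)%N -> f i = g i.
Proof.
elim: k f g => [|k IH] f g fb gb //.
have shift (h : nat -> nat) :
    (\sum_(i < k.+1) h i * b ^ i = (\sum_(i < k) h i.+1 * b ^ i) * b + h 0)%N.
  rewrite big_ord_recl expn0 muln1 addnC big_distrl; congr addn.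
  by apply: eq_bigr => i _; rewrite /= -mulnA expnSr.
rewrite !shift => e; have b0 : (0 < b)%N by apply: leq_ltn_trans (fb 0%N).
have e0 : f 0%N = g 0%N.
  by have := congr1 (modn^~ b) e; rewrite !modnMDl !modn_small.
move/eqP: e; rewrite e0 eqn_add2r eqn_pmul2r // => /eqP e [//|i] ik.
by apply: (IH (f \o succn) (g \o succn)) => [j|j||] //=.
Qed.

Lemma degree_weight_inj (b : nat) x y :
  (forall i, (x i < b)%N /\ ((b <= i)%N -> x i = 0%N)) ->
  (forall i, (y i < b)%N /\ ((b <= i)%N -> y i = 0%N)) ->
  degree_weight b b x = degree_weight b b y -> x = y.
Proof.
move=> xb yb e; apply/msetP => i; have [ib|ib] := ltnP i b.
  by apply: digits_inj e i ib => j; [case: (xb j)|case: (yb j)].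
by rewrite (xb i).2 // (yb i).2.
Qed.

Definition degree_of (k : nat) (g : nat -> nat) : degree :=
  iteri k (fun i d => (d `+` msetn (g i) i)%mset) mset0.

Lemma degree_ofE k g i : degree_of k g i = if (i < k)%N then g i else 0%N.
Proof.
elim: k => [|k IH]; first by rewrite mset0E.
rewrite /degree_of /= msetE2 -/(degree_of k g) IH msetnE.
by rewrite ltnS; case: (ltngtP i k) => [_|_|->]; rewrite ?addn0 ?add0n.
Qed.

End Degrees.

(** * Averages over characters and over boxes *)

Section Averages.
Variables (R : realType) (L : Ngraph).

(** The characters are powers [(z^j)^(w x)], with [w] the digit weight and [z] a primitive root of
    order above all weights on [Ds], so that distinct degrees keep distinct exponents. *)
Lemma character_average (Ds : seq degree) :
  exists (N : nat) (chi : 'I_N -> degree -> R[i]),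
    (forall j, is_character (chi j)) /\
    {in Ds &, forall x y,
      N%:R^-1 * \sum_j chi j x * conjc (chi j y) = (x == y)%:R}.
Proof.
have [b hb] := degree_bound Ds.
pose w := degree_weight b b.
pose N := (\sum_(x <- Ds) w x)%N.+1.
have wN x : x \in Ds -> (w x < N)%N.
  by move=> xD; rewrite ltnS (big_rem x) //= leq_addr.
have [z zP] := prim_root_exists R (ltn0Sn (\sum_(x <- Ds) w x)%N).
exists N, (fun j x => (z ^+ j) ^+ w x); split.
  move=> j; split=> [n|m n].
    by rewrite !nmcX (nm_root_of_unity _ (prim_expr_order zP)) ?expr1n.
  by rewrite /w degree_weightD exprD.
move=> x y xD yD; rewrite (prim_root_average zP) ?wN //; congr (nat_of_bool _)%:R.
by apply/eqP/eqP => [|->//]; apply: degree_weight_inj; exact: hb.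
Qed.

Section Herz.
Variables (I : finType) (D : I -> degree).
Hypotheses (D_inj : injective D) (I0 : (0 < #|I|)%N).

(** Divided by [#|I|] and not by its square: as [D] is injective, for given [x], [y] each [f] is
    matched by at most one [g], and the weight lies in [[0, 1]]. *)
Definition folner_weight : weight R :=
  fun x y => #|I|%:R^-1 * \sum_f \sum_g shift_weight R (D f) (D g) x y.

(* The weight is the average of the rotations [chi x * conjc (chi y)] against the
   positive Fejer kernel [|sum_f chi (D f)|^2 / #|I|], whose mean is [1]. *)
Lemma nm_ev_folner (A : cstarAlgType R) (s : L -> A) (r : seq (entry R L)) :
  universal_CK_family s ->
  nm (ev s folner_weight r) <= nm (ev s (@unit_weight R) r).
Proof.
move=> hs.
(* [mset0] is included so that the total mass of [K] can be read off as the weight at [mset0],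
   [mset0]. *)
pose degs := mset0 :: [seq gdeg e.1.2 | e <- r] ++ [seq gdeg e.2 | e <- r].
pose Ds := [seq (D f `+` x)%mset | f <- enum I, x <- degs].
have DsP f x : x \in degs -> (D f `+` x)%mset \in Ds.
  by move=> xd; apply/allpairsP; exists (f, x); rewrite mem_enum.
have [N [chi [hc avg]]] := character_average Ds.
pose K j : R := N%:R^-1 * (#|I|%:R^-1 * nm (\sum_f chi j (D f)) ^+ 2).
have K0 j : 0 <= K j.
  by rewrite mulr_ge0 ?invr_ge0 ?ler0n // mulr_ge0 ?invr_ge0 ?ler0n ?sqr_ge0.
have wE x y : x \in degs -> y \in degs ->
    folner_weight x y = \sum_j (K j)%:C%C * (chi j x * conjc (chi j y)).
  move=> xd yd; rewrite /folner_weight.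
  under eq_bigr => f _ do under eq_bigr => g _ do
    rewrite /shift_weight -avg ?DsP //.
  under eq_bigr => f _ do rewrite -mulr_sumr exchange_big /=.
  rewrite -mulr_sumr exchange_big /= mulrCA !mulr_sumr; apply: eq_bigr => j _.
  rewrite /K !rmorphM !fmorphV !rmorph_nat /= -!mulrA; congr (_ * (_ * _)).
  rewrite mulrA -rmorphM /= -expr2 -mulcJ rmorph_sum /= -mulrA mulr_suml.
  apply: eq_bigr => f _.
  rewrite mulr_suml mulr_sumr; apply: eq_bigr => g _.
  have [_ hD] := hc j; rewrite !hD rmorphM /=; ring.
have K1 : \sum_j K j = 1.
  apply: complexI; rewrite rmorph_sum rmorph1 /=.
  have d0 : mset0 \in degs by rewrite inE eqxx.
  transitivity (folner_weight mset0 mset0).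
    by rewrite wE //; apply: eq_bigr => j _; rewrite characterJ // mulr1.
  rewrite /folner_weight.
  have -> : \sum_f \sum_g shift_weight R (D f) (D g) mset0 mset0 = #|I|%:R.
    rewrite -sum1_card natr_sum; apply: eq_bigr => f _.
    rewrite (bigD1 f) //= big1 => [|g gf]; rewrite /shift_weight ?eqxx ?addr0 //.
    by rewrite !msetD0 (inj_eq D_inj) eq_sym (negPf gf).
  by rewrite mulVf // pnatr_eq0 -lt0n.
rewrite (@eq_ev _ _ _ _ _ (fun x y => \sum_j (K j)%:C%C * (chi j x * conjc (chi j y)))).
  rewrite (ev_sum_weight s _ (fun j => (K j)%:C%C)
    (fun j x y => chi j x * conjc (chi j y))).
  apply: le_trans (nm_sum _ _ _) _; rewrite -[leRHS]mul1r -K1 mulr_suml.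
  apply: ler_sum => j _; rewrite nmZ nmc_real ger0_norm // ler_wpM2l //.
  exact: nm_ev_rotate.
move=> e er; apply: wE; rewrite inE mem_cat.
  by rewrite (map_f (fun e => gdeg e.1.2) er) orbT.
by rewrite (map_f (fun e => gdeg e.2) er) !orbT.
Qed.

Definition folner_count (x y : degree) : nat :=
  \sum_f \sum_g ((D f `+` x)%mset == (D g `+` y)%mset).

Lemma folner_weightE x y :
  folner_weight x y = ((folner_count x y)%:R / #|I|%:R : R)%:C%C.
Proof.
rewrite mulrC rmorphM fmorphV !rmorph_nat /folner_weight /= natr_sum; congr (_ * _).
by apply: eq_bigr => f _; rewrite natr_sum.
Qed.

Lemma folner_count_le x y : (folner_count x y <= #|I|)%N.
Proof.
rewrite -sum1_card; apply: leq_sum => f _.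
have [g0 /eqP g0P|h] := pickP (fun g => (D f `+` x)%mset == (D g `+` y)%mset); last first.
  by rewrite big1 // => g _; rewrite h.
rewrite (bigD1 g0) //= big1 ?addn0 ?leq_b1 // => g gg0; rewrite g0P.
apply/eqP; rewrite eqb0; apply: contra gg0 => /eqP h; apply/eqP/D_inj.
by rewrite -(msetDKBC y (D g)) -h msetDKBC.
Qed.

End Herz.

(** The box holds the degrees with support below [T] and entries below [M]. Translation by [x - y]
    keeps at least [M - 2 T] of the [M] values in each of [T] coordinates, a proportion of at least
    [1 - 2 T^2 / M]. *)
Lemma folner_box (Ds : seq degree) (d : R) : 0 < d ->
  exists (I : finType) (D : I -> degree),
    [/\ injective D, (0 < #|I|)%N &
      {in Ds &, forall x y, (1 - d) * #|I|%:R <= (folner_count D x y)%:R}].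
Proof.
move=> d0; have [T hT] := degree_bound Ds.
have [M hM] : exists M, (2 * T + Num.bound (T%:R * (2 * T)%:R / d) < M)%N.
  by eexists; exact: ltnSn.
pose I := {ffun 'I_T -> 'I_M}.
pose ext (f : I) (i : nat) : nat := if insub i is Some j then f j else 0%N.
have extE (f : I) (i : 'I_T) : ext f i = f i by rewrite /ext valK.
pose D (f : I) := degree_of T (ext f).
have DE f (i : 'I_T) : D f i = f i by rewrite /D degree_ofE ltn_ord extE.
have cI : #|I| = (M ^ T)%N by rewrite card_ffun !card_ord.
exists I, D; split.
- move=> f g fg; apply/ffunP => i; apply: val_inj.
  by rewrite /= -!DE fg.
- by rewrite cI expn_gt0; lia.
move=> x y xD yD.
(* For these [a] the value [a + x i - y i] is again in the box; it is the coordinate of the partner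
   of [f]. *)
pose good (i : 'I_T) := [pred a : 'I_M | (y i <= a)%N && (a + x i < M)%N].
have good_card i : (M - 2 * T <= #|good i|)%N.
  have [xT _] := hT x xD i; have [yT _] := hT y yD i.
  have hlt (a : 'I_(M - 2 * T)) : (y i + a < M)%N by have := ltn_ord a; lia.
  have hinj : injective (fun a => Ordinal (hlt a)).
    by move=> a b /(congr1 val) /= /addnI /val_inj.
  rewrite -[leqLHS]card_ord -(card_codom hinj); apply: subset_leq_card.
  apply/fintype.subsetP => _ /codomP[[a aM] ->]; rewrite inE /= leq_addr.
  by move: (x i) (y i) xT yT => xi yi; lia.
have count_ge : ((M - 2 * T) ^ T <= folner_count D x y)%N.
  apply: (@leq_trans #|family good|).
    rewrite card_family foldrE big_map big_enum /=.
    rewrite -[X in (_ ^ X <= _)%N](card_ord T) -prod_nat_const.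
    by apply: leq_prod => i _; exact: good_card.
  rewrite -sum1_card big_mkcond; apply: leq_sum => f _.
  case: ifP => // /familyP fgood.
  have glt i : (f i + x i - y i < M)%N by have := fgood i; rewrite inE /=; lia.
  rewrite (bigD1 [ffun i => Ordinal (glt i)]) //=.
  rewrite (_ : _ == _) ?leq_addr //; apply/eqP/msetP => i; rewrite !msetE2.
  have [iT|iT] := ltnP i T; last first.
    by rewrite !degree_ofE ltnNge iT /= (hT x xD i).2 // (hT y yD i).2.
  rewrite !(DE _ (Ordinal iT)) ffunE /=.
  by have := fgood (Ordinal iT); rewrite inE /=; lia.
have M0 : 0 < M%:R :> R by rewrite ltr0n; lia.
pose t : R := (2 * T)%:R / M%:R.
have t0 : 0 <= t by rewrite divr_ge0.
have t1 : t <= 1 by rewrite ler_pdivrMr // mul1r ler_nat; lia.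
have bern n : 1 - n%:R * t <= (1 - t) ^+ n.
  elim: n => [|n IH]; first by rewrite mul0r subr0.
  rewrite exprS -natr1.
  have : 0 <= n%:R * t by rewrite mulr_ge0.
  have := ler_wpM2l (_ : 0 <= 1 - t) IH => /(_ ltac:(lra)); nra.
have td : T%:R * t <= d.
  rewrite mulrA ler_pdivrMr // [d * _]mulrC -ler_pdivrMr //.
  apply: le_trans (ltW (archi_boundP _)) _; first by rewrite divr_ge0 ?mulr_ge0 // ltW.
  by rewrite ler_nat; apply: leq_trans (ltnW hM); exact: leq_addl.
apply: le_trans (_ : (M - 2 * T)%:R ^+ T <= _); last by rewrite -natrX ler_nat.
have -> : (M - 2 * T)%:R = M%:R * (1 - t) :> R.
  rewrite natrB; last by lia.
  rewrite mulrBr mulr1 /t mulrCA mulfV ?mulr1 //.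
  by rewrite gt_eqF.
rewrite exprMn cI natrX mulrC ler_wpM2l ?exprn_ge0 //; have := bern T; lra.
Qed.

End Averages.

(** * Triviality of the kernel *)

Section Kernel.
Variables (R : realType) (L : Ngraph) (rf : row_finite L) (ap : aperiodic L).
Variables (A : cstarAlgType R) (s : L -> A) (hs : universal_CK_family s).
Variables (B : cstarAlgType R) (t : L -> B) (ht : CK_family t).
Variables (pi : {linear A -> B}) (pi_morph : star_morphism pi).
Hypotheses (pi_s : forall l : L, pi (s l) = t l) (t_neq0 : forall v, t (gid v) <> 0).

(** The mean has [#|I|^2] terms, bounded by [nm_ev_shift], and the divisor [#|I|]. *)
Lemma nm_ev_folner_le (I : finType) (D : I -> degree) (r : seq (entry R L)) :
  (0 < #|I|)%N ->
  nm (ev s (folner_weight R D) r) <= #|I|%:R * nm (pi (ev s (@unit_weight R) r)).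
Proof.
move=> I0; rewrite (ev_morphism _ _ pi_morph pi_s).
have wE x y : folner_weight R D x y =
    \sum_p #|I|%:R^-1 * shift_weight R (D p.1) (D p.2) x y.
  by rewrite /folner_weight pair_big /= mulr_sumr.
rewrite (@eq_ev _ _ _ _ _ (fun x y =>
    \sum_p #|I|%:R^-1 * shift_weight R (D p.1) (D p.2) x y)) //.
rewrite (ev_sum_weight s _ (fun=> #|I|%:R^-1)
    (fun p x y => shift_weight R (D p.1) (D p.2) x y)).
apply: le_trans (nm_sum _ _ _) _.
apply: le_trans (ler_sum _ (_ : forall p, _ -> _ <=
    #|I|%:R^-1 * nm (ev t (@unit_weight R) r))) _.
  move=> p _; rewrite nmZ nmcV nmc_nat ler_wpM2l ?invr_ge0 //.
  exact: (nm_ev_shift rf _ _ _ (universal_CK hs) ht ap t_neq0 pi_morph pi_s).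
rewrite sumr_const card_prod -[leLHS]mulr_natr natrM le_eqVlt; apply/orP; left.
by apply/eqP; field; rewrite pnatr_eq0 -lt0n.
Qed.

Lemma kernel_trivial (a : A) : pi a = 0 -> a = 0.
Proof.
move=> pa; have hsA := universal_CK hs.
have dense := span_dense rf hsA (universal_generated hs) a.
have piC := nm_star_morphism pi_morph.
(* One [e] each for [a - a0], [a0 - b0] and [b1], and two for [b0 - b1], which is bounded by
   [a0 - a1]. *)
suff small (e : R) : 0 < e -> nm a <= 5 * e.
  apply: nm_eq0; apply/eqP; rewrite eq_le nm_ge0 andbT.
  by apply/ler_addgt0Pl => e e0; have := small (e / 5); lra.
move=> e0; have [r0 h0] := dense e e0.
pose C := \sum_(x <- r0) nm x.1.1.
have C0 : 0 <= C by apply: sumr_ge0 => *; exact: nm_ge0.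
have C1 : 0 < C + 1 by lra.
(* The weights on [r0] will be within [d] of 1, so the mean moves [a0] by at most [d * C <= e]. *)
pose d := e / (C + 1).
have d0 : 0 < d by exact: divr_gt0.
have dC : d * C <= e.
  by rewrite mulrAC ler_pdivrMr // ler_wpM2l ?(ltW e0) //; lra.
have [I [D [D_inj I0 box]]] :=
  folner_box ([seq gdeg x.1.2 | x <- r0] ++ [seq gdeg x.2 | x <- r0]) d0.
have I1 : 1 <= #|I|%:R :> R by rewrite ler1n.
have Ipos : 0 < #|I|%:R :> R by rewrite ltr0n.
have [r1 h1] := dense _ (divr_gt0 e0 Ipos).
have h1e : nm (a - ev s (@unit_weight R) r1) < e.
  apply: lt_le_trans h1 _; rewrite ler_pdivrMr //; have := ler_wpM2l (ltW e0) I1; lra.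
set a0 := ev s (@unit_weight R) r0 in h0; set a1 := ev s (@unit_weight R) r1 in h1 h1e.
pose b0 := ev s (folner_weight R D) r0; pose b1 := ev s (folner_weight R D) r1.
have s1 : nm (a0 - b0) <= e.
  rewrite /a0 /b0 ev_sub_weight; apply: le_trans (nm_ev hsA _) dC => x xr.
  rewrite /unit_weight folner_weightE -(rmorph1 (@real_complex_def R (Phant R))) -rmorphB.
  rewrite nmc_real ger0_norm.
    rewrite lerBlDr -lerBlDl ler_pdivlMr //; apply: box; rewrite mem_cat.
      by rewrite (map_f (fun x => gdeg x.1.2) xr).
    by rewrite (map_f (fun x => gdeg x.2) xr) orbT.
  by rewrite subr_ge0 ler_pdivrMr // mul1r ler_nat folner_count_le.
have s2 : nm (b0 - b1) <= nm (a0 - a1).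
  have := nm_ev_folner D_inj I0 (r0 ++ entry_scale (- 1) r1) hs.
  by rewrite !ev_cat !ev_scale !scaleN1r.
have s3 : nm b1 <= e.
  apply: le_trans (nm_ev_folner_le D r1 I0) _; rewrite mulrC -ler_pdivlMr //.
  (* Since [pi a = 0], [pi a1] is the image of [a1 - a]. *)
  apply: le_trans (ltW h1); rewrite -[pi _]subr0 -pa -linearB.
  by apply: le_trans (piC _) _; rewrite nmBC.
have := nmD (a - a0) (a0 - b0); have := nmD (a - a0 + (a0 - b0)) (b0 - b1).
have := nmD (a - a0 + (a0 - b0) + (b0 - b1)) b1.
have := nmD (a0 - a) (a - a1); rewrite (nmBC a0 a).
rewrite !subrKA subrK.
lra.
Qed.

End Kernel.

Theorem theorem3p5 (R : realType) (L : Ngraph)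
    (rf : row_finite L) (ap : aperiodic L) (ns : no_sources L)
    (A : cstarAlgType R) (s : L -> A) (hs : universal_CK_family s)
    (B : cstarAlgType R) (t : L -> B) (ht : CK_family t)
    (pi : {linear A -> B}) (pi_morph : star_morphism pi)
    (pi_s : forall l : L, pi (s l) = t l)
    (t_neq0 : forall v : gobj L, t (gid v) <> 0) :
  injective pi.
Proof.
move=> x y xy; apply/eqP; rewrite -subr_eq0; apply/eqP.
apply: (kernel_trivial rf ap hs ht pi_morph pi_s t_neq0).
by rewrite linearB xy subrr.
Qed.
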